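(* Let $0<a<b$, let $A\in\mathbb C^{n\times n}$ be Hermitian positive definite with spectrum contained in $[a,b]$, let $v\in\mathbb C^{n\times s}$, and let $f$ be a Cauchy-Stieltjes function. Let $\ell\ge 1$, let $U$ be an orthonormal basis of $\mathcal{RK}_\ell(A,v,\Psi_{C,\ell}^{[a,b]})$, and set $A_\ell=U^*AU$, $v_\ell=U^*v$, $x_\ell=Uf(A_\ell)v_\ell$. Then $$\|f(A)v-x_\ell\|_2\le 8\,f(a)\,\|v\|_2\,\rho_{[a,4b]}^{\ell}.$$
   Context: A function $f$ on $\mathbb C\setminus\mathbb R_-$ (with $\mathbb R_-=(-\infty,0]$) is Cauchy-Stieltjes if $f(z)=\int_0^\infty\frac{\mu(t)}{t+z}\,dt$, where $\mu(t)\,dt$ is a non-negative measure on $[0,\infty)$ ($\mu$ may be a distribution such as a Dirac delta). $\|\cdot\|_2$ is the Euclidean norm of vectors and the spectral norm of matrices (including block vectors $v\in\mathbb C^{n\times s}$). Rational Krylov subspace: for $\Psi=\{\psi_1,\dots,\psi_\ell\}\subset\mathbb C\cup\{\infty\}$ (counted with multiplicity), $\mathcal{RK}_\ell(A,v,\Psi)$ is the span of all columns of $q_\ell(A)^{-1}v, q_\ell(A)^{-1}Av,\dots,q_\ell(A)^{-1}A^\ell v$, where $q_\ell(z)=\prod_{\psi_j\ne\infty}(z-\psi_j)$ and $q_\ell(A)$ is invertible. An orthonormal basis $U$ of a subspace means a matrix whose columns form an orthonormal basis of it. For $0<\alpha<\beta$, $\rho_{[\alpha,\beta]}:=\exp\left(-\frac{\pi^2}{\log(4\beta/\alpha)}\right)$.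 Zolotarev poles: for $0<\alpha<\beta$, $\Psi_\ell^{[\alpha,\beta]}=\{\psi_1,\dots,\psi_\ell\}\subset[-\beta,-\alpha]$ denotes the set of poles of the rational function $r(z)=\prod_{j=1}^\ell\frac{z+\psi_j}{-z+\psi_j}$ which attains the minimum of $\frac{\max_{z\in[\alpha,\beta]}|r(z)|}{\min_{z\in[-\beta,-\alpha]}|r(z)|}$ over all rational functions $r=g/l$ with $g,l$ polynomials of degree at most $\ell$ (by a classical theorem of Zolotarev the minimum is attained by a function of this form). Poles used: $\Psi_{C,\ell}^{[a,b]}:=T_C^{-1}(\Psi_\ell^{[\widehat a,1]})$, where $\Delta=\sqrt{b^2-ab}$, $\widehat a=\frac{b-\Delta}{b+\Delta}$, and $T_C^{-1}(z)=\frac{(b+\Delta)z+b-\Delta}{1+z}$ (with $T_C^{-1}(-1)=\infty$). *)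

(* Defs.v *)
From HB Require Import structures.
From mathcomp Require Import all_boot all_order all_algebra.
From mathcomp Require Import complex.
From mathcomp Require Import all_classical all_reals all_analysis.

Set Implicit Arguments.
Unset Strict Implicit.
Unset Printing Implicit Defensive.

Import Order.TTheory GRing.Theory Num.Theory.
Import numFieldNormedType.Exports.
Local Open Scope classical_set_scope.
Local Open Scope ring_scope.
Local Open Scope complex_scope.
Local Open Scope sesquilinear_scope.

Definition eucl_norm {R : realType} {n : nat} (x : 'cV[R[i]]_n) : R :=
  Num.sqrt (\sum_i Normc.normc (x i 0) ^+ 2).

Definition spec_norm {R : realType} {m n : nat} (M : 'M[R[i]]_(m, n)) : R :=
  sup [set eucl_norm (M *m x) | x in [set x : 'cV_n | eucl_norm x <= 1]].

Definition cintegrable {R : realType}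
    (mu : {measure set (measurableTypeR R) -> \bar R})
    (D : set (measurableTypeR R)) (g : R -> R[i]) : Prop :=
  mu.-integrable D (fun t => (complex.Re (g t))%:E) /\
  mu.-integrable D (fun t => (complex.Im (g t))%:E).

Definition cintegral {R : realType}
    (mu : {measure set (measurableTypeR R) -> \bar R})
    (D : set (measurableTypeR R)) (g : R -> R[i]) : R[i] :=
  Rintegral mu D (fun t => complex.Re (g t))
  +i* Rintegral mu D (fun t => complex.Im (g t)).

(** In the order of [R[i]], [z <= 0] means that [z] is a nonpositive real, so
    [~~ (z <= 0)] is the slit plane; the values of [f] on the slit are
    unconstrained. *)
Definition cauchy_stieltjes {R : realType} (f : R[i] -> R[i]) : Prop :=
  exists mu : {measure set (measurableTypeR R) -> \bar R},
    forall z : R[i], ~~ (z <= 0) ->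
      cintegrable mu `[0, +oo[ (fun t => (t%:C + z)^-1) /\
      f z = cintegral mu `[0, +oo[ (fun t => (t%:C + z)^-1).

Definition posdefmx {R : realType} {n : nat} (A : 'M[R[i]]_n) : Prop :=
  A \is hermsymmx /\
  forall x : 'cV[R[i]]_n, x != 0 -> 0 < (x^t* *m A *m x) 0 0.

(** [f(A)] through the unitary diagonalization of [A]; meaningful for normal
    [A] only (see [orthomx_spectralP]). *)
Definition mxfun {R : realType} {n : nat} (f : R[i] -> R[i])
    (A : 'M[R[i]]_n) : 'M[R[i]]_n :=
  invmx (spectralmx A) *m diag_mx (map_mx f (spectral_diag A))
    *m spectralmx A.

(** The pole [None] is the point at infinity; it contributes no factor. *)
Definition pole_mx {R : realType} {n : nat} (A : 'M[R[i]]_n)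
    (Psi : seq (option R[i])) : 'M[R[i]]_n :=
  \prod_(p <- pmap id Psi) (A - p%:M).

(** Subspaces are row spaces in MathComp, hence the transposition. *)
Definition rat_krylov {R : realType} {n s l : nat} (A : 'M[R[i]]_n)
    (v : 'M[R[i]]_(n, s)) (Psi : l.-tuple (option R[i])) : 'M[R[i]]_n :=
  (\sum_(j < l.+1) <<(invmx (pole_mx A Psi) *m A ^+ j *m v)^T>>)%MS.

Definition orthonormal_basis {R : realType} {n k : nat}
    (U : 'M[R[i]]_(n, k)) (V : 'M[R[i]]_n) : Prop :=
  U^t* *m U = 1%:M /\ (U^T == V)%MS.

Definition rho {R : realType} (alpha beta : R) : R :=
  expR (- (pi ^+ 2 / ln (4 * beta / alpha))).

(** [|g(z) / h(z)|] for coprime [g] and [h], infinite at the poles. *)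
Definition rat_abs {R : realType} (g h : {poly R[i]}) (z : R[i]) : \bar R :=
  if h.[z] == 0 then +oo%E else (Normc.normc (g.[z] / h.[z]))%:E.

(** With [inve 0 = +oo] and [inve +oo = 0]: for [alpha < beta] and nonzero
    coprime [g] and [h], [0 < num] and [den < +oo], so no indeterminate
    quotient occurs. *)
Definition zolotarev_ratio {R : realType} (alpha beta : R)
    (g h : {poly R[i]}) : \bar R :=
  let num := ereal_sup [set rat_abs g h x%:C | x in `[alpha, beta]] in
  let den := ereal_inf [set rat_abs g h x%:C | x in `[- beta, - alpha]] in
  (num / den)%E.

(** The zero function is excluded: its ratio is 0/0. *)
Definition ratfun {R : realType} (l : nat) (g h : {poly R[i]}) : Prop :=
  [/\ g != 0, h != 0, coprimep g h, (size g <= l.+1)%N & (size h <= l.+1)%N].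

Definition zolotarev_num {R : realType} (psi : seq R) : {poly R[i]} :=
  \prod_(p <- psi) ('X + (p%:C)%:P).

Definition zolotarev_den {R : realType} (psi : seq R) : {poly R[i]} :=
  \prod_(p <- psi) (- 'X + (p%:C)%:P).

Definition zolotarev_poles {R : realType} {l : nat} (alpha beta : R)
    (psi : l.-tuple R) : Prop :=
  (forall p, p \in psi -> - beta <= p <= - alpha) /\
  forall g h : {poly R[i]}, ratfun l g h ->
    (zolotarev_ratio alpha beta (zolotarev_num psi) (zolotarev_den psi)
     <= zolotarev_ratio alpha beta g h)%E.

Definition Delta {R : realType} (a b : R) : R := Num.sqrt (b ^+ 2 - a * b).

Definition ahat {R : realType} (a b : R) : R :=
  (b - Delta a b) / (b + Delta a b).

Definition TC_inv {R : realType} (a b : R) (z : R[i]) : option R[i] :=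
  if z == -1 then None
  else Some (((b + Delta a b)%:C * z + (b - Delta a b)%:C) / (1 + z)).

Definition PsiC {R : realType} {l : nat} (a b : R) (psi : l.-tuple R) :
    l.-tuple (option R[i]) :=
  [tuple of [seq TC_inv a b p%:C | p <- psi]].

(* Main.v *)
Require Import Defs.
From mathcomp Require Import all_boot all_order all_algebra.
From mathcomp Require Import complex.
From mathcomp Require Import all_classical all_reals all_analysis.
From mathcomp Require Import polyrcf.
From mathcomp Require Import ring lra zify.

Set Implicit Arguments.
Unset Strict Implicit.
Unset Printing Implicit Defensive.

Import Order.TTheory GRing.Theory Num.Theory.
Import numFieldNormedType.Exports.
Local Open Scope ring_scope.
Local Open Scope complex_scope.
Local Open Scope sesquilinear_scope.

(* The error at a shift [t] is that of the best rational approximation of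
   [1 / (t + z)] with the prescribed poles, since such functions are evaluated
   exactly on the Krylov space; a multiple of [R(z) / (t + z)], with [R] the
   Zolotarev function transplanted by [T_C], bounds it by [2 Z / (t + a)],
   [Z] the Zolotarev number of the two intervals, and integration yields [f(a)].

   The bound [Z <= 4 rho^l] is obtained without elliptic functions. Write
   [Z = eps^2]. Moving two neighbouring zeros apart shows that the minimizer [r]
   equioscillates, so that the [l] preimages of each [tau] in [(-eps, eps)] lie
   in [[alpha, 1]]. Multiplying the values of a product [prod |z - c| / (z + c)]
   over these preimages produces a product of the same length on an interval
   which depends only on [eps], with its bound raised to the power [l]. The same
   device for the Landen map [2 z / (1 + z^2)], iterated, bounds such a product
   from below by [(eps / 2)^N] on the latter interval; applied in the other
   direction, it reduces an upper bound on [[alpha, 1]] to a crude one as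
   [alpha] tends to 0, for which zeros in geometric progression suffice. There
   [pi^2 / 8] appears as the sum of the [1 / (2 k + 1)^2]. *)

(** * Lower bound for the sum of the 1/(2k+1)^2 *)

(** The degree [l] is fixed while the length [N] of the auxiliary product is free. Its two bounds
    read [(eps / 2)^N <= exp(- l N theta / (L + C))], and after taking the [N]-th root only the
    exponential rate of the auxiliary product is left; this is why crude bounds suffice at both ends
    of the Landen iteration. The constant 4 is that of [eps^2 = 4 (eps / 2)^2]. The 8 is twice this
    4, because the error has two parts, one from [A] and one from its compression. The passage from
    [rho] of [[ahat, 1]] to [rho] of [[a, 4 b]] is [1 / ahat = (b + Delta)^2 / (a b) <= 4 b / a].
    The integral over [t] is taken on scalars only: tested against a fixed vector, the error is a
    finite combination of values of [f], with nodes and weights that serve every function at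
    once. *)

Lemma is_derive_ge0_le (R : realType) (f df : R -> R) (a b : R) : a <= b ->
  (forall x, a <= x <= b -> is_derive x 1 f (df x)) ->
  (forall x, a <= x <= b -> 0 <= df x) -> f a <= f b.
Proof.
move=> ab fd dfge0.
have cf : ({within `[a, b], continuous f})%classic.
  apply: derivable_within_continuous => x; rewrite in_itv/= => xab.
  by have [] := fd x xab.
have [|c] := @MVT_segment R f df a b ab _ cf.
  by move=> x; rewrite in_itv/= => /andP[ax xb]; apply: fd; rewrite !ltW.
rewrite in_itv/= => cab E; rewrite -subr_ge0 E mulr_ge0 ?dfge0 //.
by rewrite subr_ge0.
Qed.

Lemma xcos_le_sin (R : realType) (x : R) :
  0 <= x <= pi / 2 -> x * cos x <= sin x.
Proof.
move=> /andP[x0 xpi].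
have /= := @is_derive_ge0_le R (fun t => sin t - t * cos t)
  (fun t => t * sin t) 0 x x0.
rewrite sin0 mul0r subr0 subr_ge0; apply.
- by move=> t _; apply: is_derive_eq; rewrite ?/GRing.scale/=; ring.
- move=> t /andP[t0 tx]; rewrite mulr_ge0 // sin_ge0_pi // t0 /=.
  by rewrite (le_trans tx)// (le_trans xpi)// ler_piMr ?pi_ge0// invf_le1 ?ler1n.
Qed.

(** The square of [x * cos x <= sin x], with [cos^2 = 1 - sin^2]. It turns an exact sum of terms
    [1 / sin^2] into a bound for the sum of the [1 / x^2]. *)
Lemma sinV2_le (R : realType) (x : R) : 0 < x < pi / 2 ->
  (sin x) ^- 2 <= 1 + x ^- 2.
Proof.
move=> /andP[x0 xpi].
have s0 : 0 < sin x by apply: sin_gt0_pihalf; rewrite x0.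
have c0 : 0 < cos x.
  apply: cos_gt0_pihalf; rewrite xpi andbT (lt_trans _ x0)//.
  by rewrite oppr_lt0 divr_gt0 ?pi_gt0.
have xc : x * cos x <= sin x by apply: xcos_le_sin; rewrite !ltW.
have -> : 1 + x ^- 2 = (x ^+ 2 + 1) / x ^+ 2 by field; rewrite gt_eqF.
rewrite ler_pdivlMr ?exprn_gt0// mulrC ler_pdivrMr ?exprn_gt0//.
have : (x * cos x) ^+ 2 <= sin x ^+ 2.
  by rewrite lerXn2r // nnegrE ?mulr_ge0// ltW.
by rewrite exprMn cos2sin2; lra.
Qed.

Lemma odd_angle_itv (R : realType) (n k : nat) : (k < 2 ^ n)%N ->
  0 < (2 * k%:R + 1) * (pi : R) / 2 ^+ n.+2 < pi / 2.
Proof.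
move=> kn; have k0 := ler0n R k; have pi0 := pi_gt0 R.
have h : (k%:R + 1 : R) <= 2 ^+ n by rewrite natr1 -natrX ler_nat.
have ? : 0 < 2 * k%:R + 1 :> R by lra.
rewrite divr_gt0 ?exprn_gt0 ?mulr_gt0//=.
have -> : pi / 2 = (2 * 2 ^+ n) * pi / 2 ^+ n.+2 :> R.
  by rewrite !exprS; field; rewrite expf_neq0.
by rewrite ltr_pM2r ?invr_gt0 ?exprn_gt0// ltr_pM2r//; lra.
Qed.

(* Induction on [n] by [1 / sin^2 x + 1 / cos^2 x = 4 / sin^2 (2 x)]. *)
Lemma sum_sinV2 (R : realType) (n : nat) :
  \sum_(0 <= k < 2 ^ n) (sin ((2 * k%:R + 1) * pi / 2 ^+ n.+2)) ^- 2
    = 2 * 4 ^+ n :> R.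
Proof.
elim: n => [|n IH].
  rewrite big_nat1 mulr0 add0r mul1r expr0 mulr1.
  have E : (2 ^+ 2 : R) = 4 by rewrite -natrX.
  have s4 : sin (pi / 4 : R) = cos (pi / 4).
    have -> : (pi / 4 : R) = pi / 2 - pi / 4 by field.
    by rewrite sinB sin_pihalf cos_pihalf mul0r mul1r subr0; congr cos; field.
  rewrite E; have := cos2Dsin2 (pi / 4 : R); rewrite s4 => h.
  have {h} -> : cos (pi / 4 : R) ^+ 2 = 2^-1 by lra.
  by rewrite invrK.
(* The upper half of the sum, reversed, pairs [k] with [2 ^ n.+1 - k.+1], whose angle is
   [pi / 2 - x]. *)
rewrite expnS mul2n -addnn (big_cat_nat _ (n := (2 ^ n)%N)) ?leq_addr//=.
rewrite -[X in _ + \sum_(X <= _ < _) _](add0n (2 ^ n)%N) big_addn addnK.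
rewrite [X in _ + X]big_nat_rev /= add0n -big_split /=.
rewrite [4 ^+ n.+1]exprS mulrCA -IH mulr_sumr; apply: eq_big_nat => k /andP[_ kn].
set x : R := (2 * k%:R + 1) * pi / 2 ^+ n.+3.
have E2 : (2 : R) ^+ n != 0 by rewrite expf_neq0.
have -> : (2 * k%:R + 1) * pi / 2 ^+ n.+2 = x *+ 2 :> R.
  by rewrite /x !exprS mulr2n; field.
have -> : (2 * ((2 ^ n - k.+1 + 2 ^ n)%N)%:R + 1) * pi / 2 ^+ n.+3
    = pi / 2 - x :> R.
  by rewrite /x natrD natrB// natrX -natr1 !exprS; field.
rewrite sinB sin_pihalf cos_pihalf mul0r mul1r subr0 sin_mulr2n.
have /andP[x0 xpi] : 0 < x < pi / 2.
  by apply: odd_angle_itv; rewrite expnS mul2n -addnn ltn_addl.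
have s0 : 0 < sin x by apply: sin_gt0_pihalf; rewrite x0.
have c0 : 0 < cos x.
  apply: cos_gt0_pihalf; rewrite xpi andbT (lt_trans _ x0)//.
  by rewrite oppr_lt0 divr_gt0 ?pi_gt0.
have sn : sin x != 0 by rewrite gt_eqF.
have cn : cos x != 0 by rewrite gt_eqF.
have -> : (sin x) ^- 2 + (cos x) ^- 2 =
    (cos x ^+ 2 + sin x ^+ 2) / (sin x ^+ 2 * cos x ^+ 2).
  by field; rewrite sn cn.
rewrite cos2Dsin2 -mulr_natl; field; by rewrite sn cn.
Qed.

(** The terms 1 of [sinV2_le] add up to [2 ^ n], small against [2 * 4 ^ n]; divided by
    [16 * 4 ^ n / pi ^+ 2] they become the subtracted error term. *)
Lemma sum_odd_inv_sqr_ge (R : realType) (n : nat) :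
  pi ^+ 2 / 8 - pi ^+ 2 / (16 * 2 ^+ n)
    <= \sum_(0 <= k < 2 ^ n) (2 * k%:R + 1) ^- 2 :> R.
Proof.
have h2 : (0 : R) < 2 ^+ n by rewrite exprn_gt0.
have pi2 : (0 : R) < pi ^+ 2 by rewrite exprn_gt0 ?pi_gt0.
have : 2 * 4 ^+ n <= \sum_(0 <= k < 2 ^ n)
    (1 + ((2 * k%:R + 1) * pi / 2 ^+ n.+2) ^- 2) :> R.
  rewrite -sum_sinV2 big_nat_cond [leRHS]big_nat_cond.
  apply: ler_sum => k /andP[/andP[_ kn] _]; apply: sinV2_le.
  exact: odd_angle_itv.
rewrite big_split /= sumr_const_nat subn0.
have -> : \sum_(0 <= k < 2 ^ n) ((2 * k%:R + 1) * pi / 2 ^+ n.+2) ^- 2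
    = 16 * 4 ^+ n / pi ^+ 2 * \sum_(0 <= k < 2 ^ n) (2 * k%:R + 1) ^- 2 :> R.
  rewrite mulr_sumr; apply: eq_bigr => k _.
  have -> : (4 : R) ^+ n = (2 ^+ n) ^+ 2.
    by rewrite -exprM mulnC exprM; congr (_ ^+ _); ring.
  have k0 : 2 * k%:R + 1 != 0 :> R by rewrite gt_eqF // ltr_wpDl ?mulr_ge0.
  have p0 : pi != 0 :> R by rewrite gt_eqF ?pi_gt0.
  rewrite !exprS; move: k0 p0 (lt0r_neq0 h2).
  by move: (2 * _ + 1) pi (2 ^+ n) => c p A c0 p0 A0; field; rewrite c0 p0 A0.
set S := \sum_(_ <= _ < _) _.
have -> : (4 : R) ^+ n = (2 ^+ n) ^+ 2.
  by rewrite -exprM mulnC exprM; congr (_ ^+ _); ring.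
rewrite natrX; set A := 2 ^+ n in h2 *; set P := pi ^+ 2 in pi2 *.
move=> H.
have : P / (16 * A ^+ 2) * (2 * A ^+ 2) <= P / (16 * A ^+ 2) * (A + 16 * A ^+ 2 / P * S).
  by rewrite ler_pM2l // divr_gt0 // mulr_gt0 ?exprn_gt0.
have -> : P / (16 * A ^+ 2) * (2 * A ^+ 2) = P / 8 by field; rewrite gt_eqF.
have -> : P / (16 * A ^+ 2) * (A + 16 * A ^+ 2 / P * S) = P / (16 * A) + S.
  by field; rewrite !gt_eqF.
by lra.
Qed.

(** The exponent is a partial sum of the power series of [ln ((1 - y) / (1 + y))], whose terms all
    have the same sign. The difference [F] increases because its derivative is
    [2 * t ^+ (2 * K) / (1 - t ^+ 2)]. *)
Lemma moebius_le_expR (R : realType) (K : nat) (y : R) : 0 <= y < 1 ->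
  (1 - y) / (1 + y)
    <= expR (- (2 * \sum_(0 <= k < K) y ^+ (2 * k).+1 / (2 * k).+1%:R)).
Proof.
move=> /andP[y0 y1].
pose P t : R := \sum_(0 <= k < K) t ^+ (2 * k).+1 / (2 * k).+1%:R.
pose F t := ln (1 + t) - ln (1 - t) - 2 * P t.
have P'E (t : R) : is_derive t 1 P (\sum_(0 <= k < K) t ^+ (2 * k)).
  rewrite /P; elim: (K) => [|m IH].
    rewrite big_nil (_ : (fun _ => _) = cst 0); first exact: is_derive_cst.
    by apply/funext => u; rewrite big_nil.
  rewrite (_ : (fun _ => _) = (fun u =>
     \sum_(0 <= k < m) u ^+ (2 * k).+1 / (2 * k).+1%:R) +
     (fun u => u ^+ (2 * m).+1 / (2 * m).+1%:R)); last first.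
    by apply/funext => u; rewrite big_nat_recr.
  rewrite big_nat_recr //=; apply: is_deriveD.
  have -> : (fun u : R => u ^+ (2 * m).+1 / (2 * m).+1%:R)
          = (2 * m).+1%:R^-1 *: (fun u : R => u ^+ (2 * m).+1).
    by apply/funext => u /=; rewrite mulrC.
  have -> : t ^+ (2 * m) = (2 * m).+1%:R^-1 *: ((2 * m).+1%:R * t ^+ (2 * m)).
    by rewrite /GRing.scale /= mulrA mulVf ?mul1r.
  apply: is_deriveZ; have := @is_deriveX _ _ id (2 * m).+1 t 1 1 (is_derive_id _ _).
  by rewrite exprfctE /GRing.scale /= mulr1.
have : F 0 <= F y.
  apply: (@is_derive_ge0_le _ F
    (fun t => (1 + t)^-1 + (1 - t)^-1 - 2 * \sum_(0 <= k < K) t ^+ (2 * k))) => //.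
  - move=> t /andP[t0 ty].
    have h1 : 0 < 1 + t by lra.
    have h2 : 0 < 1 - t by lra.
    have := is_derive1_ln h1; have := is_derive1_ln h2 => d2 d1.
    rewrite /F; apply: is_deriveB.
    have -> : (1 + t)^-1 + (1 - t)^-1 = (1 + t)^-1 - (- (1 - t)^-1) by rewrite opprK.
    apply: is_deriveB.
      have -> : (1 + t)^-1 = (1 + t)^-1 * 1 by rewrite mulr1.
      have dg : is_derive t 1 (fun u : R => 1 + u) 1.
        have := is_deriveD (is_derive_cst (1 : R) t 1) (is_derive_id t (1 : R)).
        by rewrite add0r.
      exact: (@is_derive1_comp _ (@ln R) (fun u => 1 + u)).
    have -> : - (1 - t)^-1 = (1 - t)^-1 * (- 1) by rewrite mulrN1.
    have dg : is_derive t 1 (fun u : R => 1 - u) (- 1).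
      have := is_deriveB (is_derive_cst (1 : R) t 1) (is_derive_id t (1 : R)).
      by rewrite sub0r.
    exact: (@is_derive1_comp _ (@ln R) (fun u => 1 - u)).
  - move=> t /andP[t0 ty].
    have h1 : 0 < 1 + t by lra.
    have h2 : 0 < 1 - t by lra.
    have h3 : 0 < 1 - t ^+ 2 by have := mulr_gt0 h1 h2; lra.
    have E : (1 - t ^+ 2) * \sum_(0 <= k < K) t ^+ (2 * k) = 1 - t ^+ (2 * K).
      rewrite big_mkord -[1 in RHS](expr1n R K) exprM subrXX; congr (_ * _).
      by apply: eq_bigr => i _; rewrite expr1n mul1r exprM.
    have -> : \sum_(0 <= k < K) t ^+ (2 * k) = (1 - t ^+ (2 * K)) / (1 - t ^+ 2).
      by rewrite -E [X in _ = X / _]mulrC mulfK ?gt_eqF.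
    have -> : (1 + t)^-1 + (1 - t)^-1 - 2 * ((1 - t ^+ (2 * K)) / (1 - t ^+ 2))
        = 2 * t ^+ (2 * K) / (1 - t ^+ 2).
      have h3' := lt0r_neq0 h3; move: h3'.
      have -> : 1 - t ^+ 2 = (1 - t) * (1 + t) by ring.
      by move=> _; field; rewrite !gt_eqF.
    by rewrite divr_ge0 ?mulr_ge0 ?exprn_ge0 // ltW.
have -> : F 0 = 0.
  rewrite /F addr0 subr0 ln1 /P big1_seq ?mulr0 ?subrr // => i _.
  by rewrite exprS !mul0r.
rewrite /F => H.
have h1 : 0 < 1 + y by lra.
have h2 : 0 < 1 - y by lra.
rewrite -[X in X <= _](lnK) ?posrE ?divr_gt0// ler_expR ln_div ?posrE//.
move: H; rewrite -/(P y); lra.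
Qed.
(** * Landen transformation and lower bound *)

(* [|r(z)|], [z > 0], for [r(z) = prod (z - p) / (z + p)]: in the Zolotarev form
   the zeros [c] are the opposites of the poles. *)
Definition blaschke (R : realType) (c : seq R) (z : R) : R :=
  \prod_(p <- c) (`|z - p| / (z + p)).

Lemma blaschke_nil (R : realType) (z : R) : blaschke [::] z = 1.
Proof. by rewrite /blaschke big_nil. Qed.

Lemma blaschke_cons (R : realType) p (c : seq R) (z : R) :
  blaschke (p :: c) z = `|z - p| / (z + p) * blaschke c z.
Proof. by rewrite /blaschke big_cons. Qed.

Lemma perm_blaschke (R : realType) (c d : seq R) (z : R) :
  perm_eq c d -> blaschke c z = blaschke d z.
Proof. exact: perm_big. Qed.

Lemma blaschke_factor_le1 (R : realType) (z p : R) : 0 < z -> 0 < p ->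
  0 <= `|z - p| / (z + p) <= 1.
Proof.
move=> z0 p0; have s0 : 0 < z + p by rewrite addr_gt0.
rewrite divr_ge0 ?(ltW s0)//=.
by rewrite ler_pdivrMr ?addr_gt0// mul1r ler_norml; apply/andP; split; lra.
Qed.

Lemma blaschke_itv01 (R : realType) (c : seq R) (z : R) : 0 < z ->
  {in c, forall p, 0 < p} -> 0 <= blaschke c z <= 1.
Proof.
move=> z0; elim: c => [|p c IH] cpos; first by rewrite blaschke_nil ler01 lexx.
have /andP[h1 h2] : 0 <= `|z - p| / (z + p) <= 1.
  by apply: blaschke_factor_le1 => //; apply: cpos; rewrite inE eqxx.
have /andP[h3 h4] := IH (fun q qc => cpos q (mem_behead (s := p :: c) qc)).
by rewrite blaschke_cons mulr_ge0 // mulr_ile1.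
Qed.

Lemma blaschke_ge0 (R : realType) (c : seq R) (z : R) : 0 < z ->
  {in c, forall p, 0 < p} -> 0 <= blaschke c z.
Proof. by move=> z0 /(blaschke_itv01 z0) /andP[]. Qed.

Lemma blaschke_scale (R : realType) (k : R) (c : seq R) (z : R) : 0 < k ->
  blaschke [seq k * p | p <- c] (k * z) = blaschke c z.
Proof.
move=> k0; rewrite /blaschke big_map; apply: eq_bigr => p _.
rewrite -mulrBr -mulrDr normrM gtr0_norm// -mulf_div divff ?mul1r//.
by rewrite gt_eqF.
Qed.

(** The interval is invariant under [z |-> z^-1], so it contains both preimages of a point under the
    Landen map or neither. *)
Definition blaschke_le (R : realType) (c : seq R) (kappa M : R) : Prop :=
  {in c, forall p, 0 < p} /\
  forall z, kappa < z < kappa^-1 -> blaschke c z <= M.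

(** Intermediate value theorem for [w * (1 + z ^+ 2) - 2 * z], which is positive at [kappa] and at
    most 0 at 1. *)
Lemma landen_preimage (R : realType) (kappa w : R) : 0 < kappa < 1 ->
  2 * kappa / (1 + kappa ^+ 2) < w <= 1 ->
  exists2 z, kappa < z <= 1 & w = 2 * z / (1 + z ^+ 2).
Proof.
move=> /andP[k0 k1] /andP[kw w1].
have w0 : 0 < w.
  by apply: le_lt_trans kw; rewrite divr_ge0 ?mulr_ge0 ?addr_ge0 ?exprn_ge0 // ltW.
pose p : {poly R} := w *: 'X^2 - 2 *: 'X + w%:P.
have pE z : p.[z] = w * z ^+ 2 - 2 * z + w.
  by rewrite /p !hornerE.
have h : 0 < 1 + kappa ^+ 2 by rewrite addr_gt0 // exprn_gt0.
have pk : 0 < p.[kappa].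
  by rewrite pE; move: kw; rewrite ltr_pdivrMr//; lra.
have [z] : exists2 z, z \in `[kappa, 1] & p.[z] = 0.
  have [|z zk /rootP pz] := @polyrcf.poly_ivt R p kappa 1 (ltW k1); last by exists z.
  by rewrite pmulr_rle0 // pE; lra.
rewrite in_itv /= => /andP[kz z1] pz; exists z.
  rewrite z1 andbT lt_neqAle kz andbT; apply: contraTneq pk => ->.
  by rewrite pz ltxx.
have h2 : 0 < 1 + z ^+ 2 by rewrite addr_gt0 // exprn_gt0 // (lt_le_trans k0).
apply: (mulIf (lt0r_neq0 h2)); rewrite divfK ?(lt0r_neq0 h2)//.
by move: pz; rewrite pE; lra.
Qed.

(* [z] and [z^-1] are the two preimages of [2 z / (1 + z^2)]. *)
Lemma blaschke_landen (R : realType) (c : seq R) (z : R) : 0 < z ->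
  {in c, forall p, 0 < p} ->
  blaschke [seq 2 * p / (1 + p ^+ 2) | p <- c] (2 * z / (1 + z ^+ 2))
    = blaschke c z * blaschke c z^-1.
Proof.
move=> z0 cpos; rewrite /blaschke big_map -big_split /= big_seq [RHS]big_seq.
apply: eq_bigr => p /cpos p0.
have hz : 0 < 1 + z ^+ 2 by rewrite addr_gt0 // exprn_gt0.
have hp : 0 < 1 + p ^+ 2 by rewrite addr_gt0 // exprn_gt0.
have h1 : 0 < z + p by rewrite addr_gt0.
have h2 : 0 < 1 + z * p by rewrite addr_gt0 // mulr_gt0.
have zV : 0 < z^-1 by rewrite invr_gt0.
have h3 : 0 < z^-1 + p by rewrite addr_gt0.
have E1 : 2 * z / (1 + z ^+ 2) - 2 * p / (1 + p ^+ 2)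
    = 2 * z / (1 + z ^+ 2) / (1 + p ^+ 2) * ((z - p) * (z^-1 - p)).
  by field; rewrite !lt0r_neq0.
have E2 : 2 * z / (1 + z ^+ 2) + 2 * p / (1 + p ^+ 2)
    = 2 * z / (1 + z ^+ 2) / (1 + p ^+ 2) * ((z + p) * (z^-1 + p)).
  by field; rewrite !lt0r_neq0.
have h4 : 0 < 2 * z / (1 + z ^+ 2) / (1 + p ^+ 2).
  by rewrite !divr_gt0 ?mulr_gt0.
rewrite E1 E2 normrM (gtr0_norm h4) normrM -mulf_div divff ?(lt0r_neq0 h4)//.
by rewrite mul1r mulf_div.
Qed.

(** The Landen map folds the interval onto the points between [kappa' ^+ 2] and 1; division by
    [kappa'] makes the image symmetric under inversion again. Each value of the new product is a
    product of two values of the old one, hence [M ^+ 2]. *)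
Lemma blaschke_le_landen (R : realType) (c : seq R) (kappa kappa' M : R) :
  0 < kappa < 1 -> 0 < kappa' -> kappa' ^+ 2 = 2 * kappa / (1 + kappa ^+ 2) ->
  blaschke_le c kappa M ->
  exists2 d, size d = size c & blaschke_le d kappa' (M ^+ 2).
Proof.
move=> k01 k'0 k'E [cpos cM]; have /andP[k0 k1] := k01.
exists [seq kappa'^-1 * p | p <- [seq 2 * p / (1 + p ^+ 2) | p <- c]].
  by rewrite !size_map.
split=> [q /mapP[p' /mapP[p pc ->] ->]|w /andP[kw wk]].
  have p0 := cpos p pc.
  by rewrite mulr_gt0 ?invr_gt0 ?divr_gt0 ?mulr_gt0 ?addr_gt0 ?exprn_gt0.
have [|z /andP[kz z1] wE] := @landen_preimage R kappa (kappa' * w) k01.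
  rewrite -k'E expr2 ltr_pM2l// kw /=.
  by rewrite -ler_pdivlMl // mulr1 ltW.
have z0 : 0 < z := lt_trans k0 kz.
have -> : w = kappa'^-1 * (kappa' * w) by rewrite mulKf // gt_eqF.
rewrite blaschke_scale ?invr_gt0// wE blaschke_landen// expr2.
have zV : z < kappa^-1.
  by rewrite (le_lt_trans z1)// invf_gt1.
apply: ler_pM; rewrite ?blaschke_ge0 ?invr_gt0//; first by apply: cM; rewrite kz.
apply: cM; rewrite ltf_pV2 ?posrE // kz andbT.
by rewrite (lt_le_trans k1)// invf_ge1.
Qed.
Lemma expr_size_le_prod (R : realType) (T : eqType) (c : seq T) (F : T -> R)
  (x : R) : 0 <= x -> {in c, forall p, x <= F p} ->
  x ^+ size c <= \prod_(p <- c) F p.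
Proof.
move=> x0; elim: c => [|p c IH] H; first by rewrite big_nil.
rewrite big_cons exprS ler_pM ?exprn_ge0// ?H ?mem_head//.
by apply: IH => q qc; apply: H; rewrite inE qc orbT.
Qed.

(* Of the [size c + 1] cells of equal length in [[kappa, 1]], one contains no
   zero; its midpoint is far from all of them. *)
Lemma blaschke_crude_lower (R : realType) (c : seq R) (kappa : R) :
  0 < kappa < 1 -> {in c, forall p, 0 < p} ->
  exists2 z, kappa < z < 1 &
    ((1 - kappa) / (6 * (size c).+1%:R)) ^+ size c <= blaschke c z.
Proof.
move=> /andP[k0 k1] cpos.
set N := size c; set d := (1 - kappa) / (2 * N.+1%:R).
have N0 : 0 < N.+1%:R :> R by [].
have d0 : 0 < d by rewrite divr_gt0 ?subr_gt0 ?mulr_gt0.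
have dE : (2 * N.+1%:R) * d = 1 - kappa.
  by rewrite mulrC divfK // mulf_neq0 // gt_eqF.
pose m (i : 'I_N.+1) : R := kappa + (2 * i%:R + 1) * d.
have mdist i j : `|m i - m j| = 2 * d * `|i%:R - j%:R|.
  have -> : m i - m j = (2 * d) * (i%:R - j%:R) by rewrite /m; ring.
  by rewrite normrM gtr0_norm // mulr_gt0.
have mitv i : kappa < m i < 1.
  have i0 : 0 <= i%:R :> R by [].
  have iN : i%:R + 1 <= N.+1%:R :> R by rewrite natr1 ler_nat.
  have h1 : 0 < (2 * i%:R + 1) * d by rewrite mulr_gt0 // ltr_wpDl // mulr_ge0.
  have h2 : (2 * i%:R + 1) * d <= (2 * N.+1%:R - 1) * d.
    by rewrite ler_pM2r //; lra.
  by apply/andP; split; rewrite /m; lra.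
have [i mfar] : exists i, forall p, p \in c -> d <= `|m i - p|.
  apply: contrapT => /forallNP near.
  have {}near i : exists j : 'I_N, `|m i - nth 0 c j| < d.
    have /existsNP[p /not_implyP[pc /negP]] := near i.
    rewrite -ltNge => pd.
    have pN : (index p c < N)%N by rewrite index_mem.
    by exists (Ordinal pN); rewrite nth_index.
  have [g gP] := choice near.
  (* Two cells served by the same zero would have midpoints less than [2 * d] apart, which is the
     distance of neighbouring midpoints. *)
  suff ginj : injective g.
    have := leq_card g ginj; by rewrite !card_ord ltnn.
  move=> i j gij; apply/val_inj/eqP; apply: contrapT => /negP ij.
  have : `|m i - m j| < 2 * d.
    have := gP j; rewrite -gij => hj; have hi := gP i.
    rewrite (le_lt_trans (ler_distD (nth 0 c (g i)) _ _))//.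
    by rewrite [X in _ + X]distrC; lra.
  rewrite mdist gtr_pMr; last by rewrite mulr_gt0.
  move=> H.
  have : 1 <= `|i%:R - j%:R| :> R.
    rewrite ler_normr; have [lt|gt|/eqP eq] := ltngtP i j.
    - have : i%:R + 1 <= j%:R :> R by rewrite natr1 ler_nat.
      by move=> h; apply/orP; right; lra.
    - have : j%:R + 1 <= i%:R :> R by rewrite natr1 ler_nat.
      by move=> h; apply/orP; left; lra.
    - by rewrite eq in ij.
  by move: H; rewrite ltNge => /negP.
exists (m i) => //; have /andP[ki mi1] := mitv i.
have m0 : 0 < m i := lt_trans k0 ki.
have -> : (1 - kappa) / (6 * N.+1%:R) = d / 3.
  by rewrite /d; move: (lt0r_neq0 N0); move: (N.+1%:R) => x x0; field.
have d1 : d <= 1.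
  by have : 2 * d <= 2 * N.+1%:R * d; [rewrite ler_pM2r // ler_peMr // ler1n|lra].
apply: expr_size_le_prod => [|p pc]; first by rewrite divr_ge0 // ltW.
have p0 := cpos p pc; have mp := mfar p pc.
have s0 : 0 < m i + p by rewrite addr_gt0.
rewrite ler_pdivlMr // mulrC mulrA ler_pdivrMr //.
(* For [p <= 2] the denominator is at most 3; for [p > 2] the factor itself exceeds 1/3, as
   [m i < 1]. This 3 and the half cell length [d] make the 6 of the statement. *)
have [p2|p2] := leP p 2.
  apply: (@le_trans _ _ (3 * d)); first by rewrite ler_pM2r //; lra.
  by rewrite mulrC ler_pM2r.
have mpE : `|m i - p| = p - m i by rewrite distrC ger0_norm ?subr_ge0 //; lra.
rewrite mpE; apply: (@le_trans _ _ (m i + p)); first by rewrite ler_piMr // ltW.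
by lra.
Qed.

(** In the coordinate [e] with [kappa = (1 - e) / (1 + e)] the Landen map squares [e]. Rescaling to
    a symmetric interval costs at most a factor 2, so [e' / 2 >= (e / 2) ^+ 2]: this is why [e / 2]
    is the quantity that iterates well. *)
Lemma landen_step_exists (R : realType) (e : R) : 0 < e < 1 ->
  exists e' : R, [/\ 0 < e' < 1, e ^+ 2 / 2 <= e' &
    ((1 - e') / (1 + e')) ^+ 2 =
      2 * ((1 - e) / (1 + e)) / (1 + ((1 - e) / (1 + e)) ^+ 2)].
Proof.
move=> /andP[e0 e1]; set k := (1 - e) / (1 + e).
have h1 : 0 < 1 + e by lra.
have h2 : 0 < 1 + e ^+ 2 by rewrite addr_gt0// exprn_gt0.
have e21 : e ^+ 2 < 1 by rewrite expr_lt1// ltW.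
have kE : 2 * k / (1 + k ^+ 2) = (1 - e ^+ 2) / (1 + e ^+ 2).
  have h3 : (1 + e) ^+ 2 + (1 - e) ^+ 2 != 0.
    by rewrite gt_eqF // ltr_wpDr ?exprn_gt0 ?sqr_ge0.
  by rewrite /k; field; rewrite !gt_eqF // ?h3; lra.
set y := Num.sqrt ((1 - e ^+ 2) / (1 + e ^+ 2)).
have yy : y ^+ 2 = (1 - e ^+ 2) / (1 + e ^+ 2).
  by rewrite sqr_sqrtr // divr_ge0 ?subr_ge0 ?(ltW e21) ?(ltW h2).
have y0 : 0 < y by rewrite sqrtr_gt0 divr_gt0 ?subr_gt0.
have y1 : y < 1.
  rewrite -[1]sqrtr1 ltr_sqrt // ltr_pdivrMr // mul1r.
  by have := exprn_gt0 2 e0; lra.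
have hy : 0 < 1 + y by lra.
exists ((1 - y) / (1 + y)); split.
- by rewrite divr_gt0 ?subr_gt0//= ltr_pdivrMr // mul1r; lra.
- rewrite ler_pdivlMr // -subr_ge0.
  have yyE : (1 + e ^+ 2) * y ^+ 2 = 1 - e ^+ 2 by rewrite yy mulrC divfK ?gt_eqF.
  have : (1 - y) ^+ 2 >= 0 by exact: sqr_ge0.
  set E := e ^+ 2 in yyE e21 h2 *.
  have yE : E * (1 + y ^+ 2) = 1 - y ^+ 2 by rewrite mulrDr mulr1; lra.
  have : 0 <= (1 - E / 2) - y * (1 + E / 2); last by lra.
  have hp : 0 < 2 * (1 + y ^+ 2) by rewrite mulr_gt0 // addr_gt0 // exprn_gt0.
  rewrite -(pmulr_rge0 _ hp).
  have -> : 2 * (1 + y ^+ 2) * (1 - E / 2 - y * (1 + E / 2))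
     = 2 * (1 + y ^+ 2) * (1 - y) - (E * (1 + y ^+ 2)) * (1 + y) by field.
  rewrite yE.
  have -> : 2 * (1 + y ^+ 2) * (1 - y) - (1 - y ^+ 2) * (1 + y)
     = (1 - y) ^+ 3 by ring.
  by rewrite exprn_ge0 // subr_ge0 (ltW y1).
- rewrite kE -yy; congr (_ ^+ 2); field; rewrite !gt_eqF //; lra.
Qed.

(** After [m] Landen steps the bound has become [M ^+ (2 ^ m)] and the parameter is at least
    [2 * (e / 2) ^+ (2 ^ m)]. The crude bound is used there, with [1 - kappa >= e]. *)
Lemma landen_iter_lower (R : realType) (m : nat) (c : seq R) (e M : R) :
  0 < e < 1 -> blaschke_le c ((1 - e) / (1 + e)) M ->
  ((6 * (size c).+1%:R)^-1 * (2 * (e / 2) ^+ (2 ^ m))) ^+ size c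
    <= M ^+ (2 ^ m).
Proof.
elim: m c e M => [|m IH] c e M e01 cM; have /andP[e0 e1] := e01.
  have k01 : 0 < (1 - e) / (1 + e) < 1.
    by rewrite divr_gt0 ?subr_gt0 //= ?ltr_pdivrMr ?mul1r; lra.
  have [cpos cle] := cM.
  have [z /andP[kz z1]] := blaschke_crude_lower k01 cpos.
  rewrite !expn0 !expr1 => h.
  have /(le_trans h) : blaschke c z <= M.
    apply: cle; rewrite kz (lt_trans z1) // invf_gt1; by case/andP: k01.
  apply: le_trans; apply: lerXn2r; rewrite ?nnegrE.
  - by rewrite mulr_ge0 ?invr_ge0 // mulr_ge0 // divr_ge0 // ltW.
  - by rewrite divr_ge0 // subr_ge0 ltW //; case/andP: k01.
  rewrite [leRHS]mulrC ler_pM2l ?invr_gt0 ?mulr_gt0 //.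
  have -> : 2 * (e / 2) = e by field.
  have -> : 1 - (1 - e) / (1 + e) = 2 * e / (1 + e) by field; rewrite gt_eqF //; lra.
  have e1' : 0 < 1 + e by lra.
  by rewrite ler_pdivlMr // mulrC [2 * e]mulrC mulrC ler_pM2l //; lra.
have [e' [e'01 ee' E]] := landen_step_exists e01; have /andP[e'0 e'1] := e'01.
have k01 : 0 < (1 - e) / (1 + e) < 1.
  by rewrite divr_gt0 ?subr_gt0 //= ?ltr_pdivrMr ?mul1r; lra.
have k'0 : 0 < (1 - e') / (1 + e') by rewrite divr_gt0 ?subr_gt0//; lra.
have [d sd dM] := blaschke_le_landen k01 k'0 E cM.
have := IH d e' _ e'01 dM; rewrite sd -exprM -expnS; apply: le_trans.
have x0 : 0 <= e / 2 by rewrite divr_ge0 // ltW.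
apply: lerXn2r; rewrite ?nnegrE ?mulr_ge0 ?invr_ge0 ?exprn_ge0//.
  by rewrite divr_ge0 // ltW.
rewrite ler_pM2l ?invr_gt0 ?mulr_gt0 // ler_pM2l // expnS exprM lerXn2r //.
- by rewrite nnegrE exprn_ge0.
- by rewrite nnegrE divr_ge0 // ltW.
- by rewrite expr_div_n; have -> : (2 ^+ 2 : R) = 4 by [rewrite -natrX]; lra.
Qed.

Lemma le_of_expn2_le (R : realType) (A D M : R) : 0 < A -> 0 < D -> 0 <= M ->
  (forall m, D * A ^+ (2 ^ m) <= M ^+ (2 ^ m)) -> A <= M.
Proof.
move=> A0 D0 M0 H; rewrite leNgt; apply/negP => MA.
have M1 : 0 < M.
  rewrite lt_neqAle M0 andbT; apply/eqP => M00.
  have := H 0; rewrite !expn0 !expr1 -M00 leNgt; by rewrite mulr_gt0.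
have r1 : 1 < A / M by rewrite ltr_pdivlMr // mul1r.
set r := A / M in r1.
have {}H m : D * r ^+ (2 ^ m) <= 1.
  by rewrite expr_div_n mulrA ler_pdivrMr ?exprn_gt0 // mul1r.
have bern n : 1 + n%:R * (r - 1) <= r ^+ n.
  elim: n => [|n IHn]; first by rewrite mul0r addr0.
  rewrite exprS -natr1; apply: (@le_trans _ _ (r * (1 + n%:R * (r - 1)))).
    have : 0 <= n%:R * (r - 1) ^+ 2 by rewrite mulr_ge0 // sqr_ge0.
    by lra.
  by rewrite ler_pM2l // (lt_trans _ r1).
pose n := (Num.truncn (D^-1 / (r - 1))).+1.
have hn : D^-1 / (r - 1) < n%:R by apply: truncnS_gt.
have {}hn : D^-1 < n%:R * (r - 1) by rewrite -ltr_pdivrMr // subr_gt0.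
have h2 : r ^+ n <= r ^+ (2 ^ n) by rewrite ler_eXn2l // ltnW // ltn_expl.
have := H n; rewrite leNgt => /negP; apply.
rewrite -ltr_pdivrMl // mulr1 (lt_le_trans hn)//.
by have := bern n; lra.
Qed.

(* The maps [z |-> 2 z / (1 + z^2)] carry [c] to interval after interval; the
   crude bound loses a factor whose [2^m]-th root tends to [1]. *)
Lemma blaschke_lower (R : realType) (c : seq R) (e M : R) :
  0 < e < 1 -> blaschke_le c ((1 - e) / (1 + e)) M ->
  (e / 2) ^+ size c <= M.
Proof.
move=> e01 cM; have /andP[e0 e1] := e01.
have ce2 : 0 < e / 2 by rewrite divr_gt0.
have M0 : 0 <= M.
  have [cpos cle] := cM.
  have k01 : 0 < (1 - e) / (1 + e) < 1.
    by rewrite divr_gt0 ?subr_gt0 //= ?ltr_pdivrMr ?mul1r; lra.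
  have [k0 k1] := andP k01.
  have /cle : (1 - e) / (1 + e) < 1 < ((1 - e) / (1 + e))^-1.
    by rewrite k1 invf_gt1.
  by apply: le_trans; rewrite blaschke_ge0.
apply: (@le_of_expn2_le _ _ (((6 * (size c).+1%:R)^-1 * 2) ^+ size c)) => //.
  by rewrite exprn_gt0.
move=> m; rewrite exprAC -exprMn -mulrA; exact: landen_iter_lower.
Qed.
(** * Asymptotic upper bound *)

(** A geometric series of ratio [Q], with [1 - Q <= h * (2 * k%:R + 1)] from [expR_ge1Dx]. The other
    factors are made independent of [k] so that they can leave the sum over [k]; they tend to 1 when
    [h K] tends to 0 and [h T] to infinity. *)
Lemma geometric_sum_ge (R : realType) (h : R) (K T k : nat) : 0 < h ->
  (k < K)%N ->
  expR (- h) ^+ (2 * K) * (1 - expR (- h) ^+ T) / (h * (2 * k%:R + 1))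
    <= \sum_(0 <= d < T) (expR (- h) ^+ d.+1) ^+ (2 * k).+1.
Proof.
move=> h0 kK; set q := expR (- h).
have q01 : 0 < q < 1 by rewrite expR_gt0 expR_lt1 oppr_lt0.
have /andP[q0 q1] := q01.
set Q := q ^+ (2 * k).+1.
have Q0 : 0 < Q by rewrite exprn_gt0.
have Q1 : Q < 1 by rewrite expr_lt1 // ltW.
have cE : (2 * k).+1%:R = 2 * k%:R + 1 :> R by rewrite -natr1 natrM.
have c0 : 0 < 2 * k%:R + 1 :> R by rewrite -cE.
have QE : 1 - Q <= h * (2 * k%:R + 1).
  rewrite /Q /q -expRM_natr cE mulNr.
  by have := expR_ge1Dx (- (h * (2 * k%:R + 1))); lra.
have -> : \sum_(0 <= d < T) (q ^+ d.+1) ^+ (2 * k).+1 = Q * (1 - Q ^+ T) / (1 - Q).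
  apply: (mulIf (lt0r_neq0 (_ : 0 < 1 - Q))); first by rewrite subr_gt0.
  rewrite divfK; last by rewrite gt_eqF // subr_gt0.
  rewrite big_mkord -[1 in RHS](expr1n _ T) subrXX mulrCA mulrC; congr (_ * _).
  rewrite mulr_sumr; apply: eq_bigr => d _.
  by rewrite expr1n mul1r -exprS -exprM mulnC exprM.
have hT : 1 - q ^+ T <= 1 - Q ^+ T.
  rewrite lerB // lerXn2r // ?nnegrE ?(ltW Q0) ?(ltW q0) //.
  by rewrite /Q exprS ler_piMr ?(ltW q0)// exprn_ile1 ?(ltW q0) ?(ltW q1).
have hT0 : 0 <= 1 - q ^+ T by rewrite subr_ge0 exprn_ile1 ?(ltW q0) ?(ltW q1).
have hQ : q ^+ (2 * K) <= Q.
  by apply: ler_wiXn2l; rewrite ?(ltW q0) ?(ltW q1) // ltn_pmul2l.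
apply: ler_pM.
- by rewrite mulr_ge0 // exprn_ge0 // ltW.
- by rewrite invr_ge0 mulr_ge0 // ltW.
- by apply: ler_pM => //; rewrite exprn_ge0 // ltW.
- by rewrite lef_pV2 // posrE ?mulr_gt0 // subr_gt0.
Qed.

(** Expanding the logarithm and summing over [d] first yields, for each [k], about
    [1 / (h (2 k + 1))] times the coefficient [1 / (2 k + 1)]. This is the origin of the inverse odd
    squares. *)
Lemma prod_moebius_le (R : realType) (h : R) (K T : nat) : 0 < h ->
  \prod_(0 <= d < T) ((1 - expR (- h) ^+ d.+1) / (1 + expR (- h) ^+ d.+1))
    <= expR (- (2 * (expR (- h) ^+ (2 * K) * (1 - expR (- h) ^+ T) / h) *
             \sum_(0 <= k < K) (2 * k%:R + 1) ^- 2)).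
Proof.
move=> h0; set q := expR (- h).
have /andP[q0 q1] : 0 < q < 1 by rewrite expR_gt0 expR_lt1 oppr_lt0.
have qd d : 0 <= q ^+ d.+1 < 1.
  by rewrite exprn_ge0 ?(ltW q0)// expr_lt1 // ltW.
apply: (@le_trans _ _ (\prod_(0 <= d < T) expR (- (2 *
   \sum_(0 <= k < K) (q ^+ d.+1) ^+ (2 * k).+1 / (2 * k).+1%:R)))).
  apply: ler_prod => d _; rewrite moebius_le_expR // andbT.
  have /andP[h1 h2] := qd d.
  by rewrite divr_ge0 ?subr_ge0 ?(ltW h2) // addr_ge0.
rewrite -expR_sum ler_expR sumrN lerN2 -mulr_sumr -mulrA ler_pM2l //.
rewrite exchange_big /= mulr_sumr [leLHS]big_nat_cond [leRHS]big_nat_cond.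
apply: ler_sum => k /andP[/andP[_ kK] _].
rewrite -mulr_suml; have := @geometric_sum_ge _ h K T k h0 kK.
have -> : (2 * k).+1%:R = 2 * k%:R + 1 :> R by rewrite -natr1 natrM.
have c0 : 0 < 2 * k%:R + 1 :> R by rewrite ltr_wpDl ?mulr_ge0.
move=> H; rewrite ler_pdivlMr //; apply: le_trans H; rewrite -/q.
rewrite le_eqVlt; apply/orP; left; apply/eqP.
move: (lt0r_neq0 c0) (lt0r_neq0 h0).
by move: (2 * _ + 1) (q ^+ _) (q ^+ _) => x y t x0 hn; field; rewrite x0 hn.
Qed.

Lemma prod_sub_nat_le (R : realType) (F : nat -> R) (a b c d : nat) :
  (a <= b)%N -> (b <= c)%N -> (c <= d)%N -> (forall j, 0 <= F j <= 1) ->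
  \prod_(a <= j < d) F j <= \prod_(b <= j < c) F j.
Proof.
move=> ab bc cd F01.
have F0 m n : 0 <= \prod_(m <= j < n) F j.
  by apply: prodr_ge0 => j _; case/andP: (F01 j).
have F1 m n : \prod_(m <= j < n) F j <= 1.
  by apply: prodr_ile1 => j _; exact: F01.
rewrite (@big_cat_nat _ _ _ b) ?(leq_trans bc)//= (@big_cat_nat _ _ _ c b) //=.
by rewrite mulrCA ler_piMr // mulr_ile1.
Qed.

Lemma blaschke_factor_le (R : realType) (u v y : R) : 0 < u -> 0 < v ->
  0 <= y -> y * u <= v -> y * v <= u -> `|u - v| / (u + v) <= (1 - y) / (1 + y).
Proof.
move=> u0 v0 y0 yu yv.
have h1 : 0 < u + v by rewrite addr_gt0.
have h2 : 0 < 1 + y by lra.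
rewrite ler_pdivrMr // mulrAC ler_pdivlMr //.
rewrite -(gtr0_norm h2) -normrM ler_norml.
by apply/andP; split; lra.
Qed.

(* Zeros in geometric progression, going past both ends of the interval: near
   [z] the factors are [tanh (d h / 2)] with [d] running over consecutive
   integers, on both sides. *)
Lemma geometric_blaschke_le (R : realType) (h kappa : R) (K T : nat) :
  0 < h -> 0 < kappa < 1 ->
  exists c : seq R, [/\ (0 < size c)%N,
    (size c)%:R * h <= 2 * ln kappa^-1 + (2 * T%:R + 3) * h &
    blaschke_le c kappa
      (expR (- (4 * (expR (- h) ^+ (2 * K) * (1 - expR (- h) ^+ T) / h) *
             \sum_(0 <= k < K) (2 * k%:R + 1) ^- 2)))].
Proof.
move=> h0 /andP[k0 k1].
set L := ln kappa^-1.
have L0 : 0 < L by rewrite ln_gt0 // invf_gt1.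
(* On the logarithmic scale [m0] steps of length [h] reach beyond [L]; the [T] further ones ensure
   that every [z] has [T] zeros on either side. *)
pose m0 := (Num.truncn (L / h)).+1; pose m := (m0 + T)%N.
have m0h : L < m0%:R * h by rewrite -ltr_pdivrMr // truncnS_gt.
have m0h' : m0%:R * h <= L + h.
  rewrite -natr1 mulrDl mul1r lerD2r -ler_pdivlMr //.
  by rewrite truncn_le // divr_ge0 // ltW.
pose P (j : nat) : R := expR ((j%:R - m%:R) * h).
have P0 j : 0 < P j by apply: expR_gt0.
exists [seq P j | j <- iota 0 (2 * m).+1]; split.
- by rewrite size_map size_iota.
- rewrite size_map size_iota -natr1 natrM /m natrD.
  by have := m0h'; lra.
split=> [p /mapP[j _ ->] //|z /andP[kz zk]].
have z0 : 0 < z := lt_trans k0 kz.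
have lz : - L < ln z < L.
  rewrite /L lnV ?posrE // opprK !ltr_ln ?posrE // kz /=.
  by rewrite -lnV ?posrE // ltr_ln ?posrE // invr_gt0.
have /andP[lz1 lz2] := lz.
rewrite /blaschke big_map.
pose F j := `|z - P j| / (z + P j); rewrite -/F.
have F01 j : 0 <= F j <= 1 by apply: blaschke_factor_le1.
(* [x] is the index, a real number, that a zero at [z] would have; the zeros next to [z] are those
   of index [i] and [i.+1]. *)
pose x := ln z / h + m%:R.
have mE : m%:R = m0%:R + T%:R :> R by rewrite natrD.
have q01 : 0 < expR (- h) < 1 by rewrite expR_gt0 expR_lt1 oppr_lt0.
have /andP[q0 q1] := q01.
have xh : x * h = ln z + m%:R * h by rewrite /x mulrDl divfK // gt_eqF.
have xT : T%:R < x by rewrite -(ltr_pM2r h0) xh mE; lra.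
have xm : x < m0%:R + m%:R by rewrite -(ltr_pM2r h0) xh; lra.
have x0 : 0 <= x by rewrite (le_trans _ (ltW xT)).
pose i := Num.truncn x.
have ix : i%:R <= x by rewrite truncn_le.
have xi : x < i.+1%:R by exact: truncnS_gt.
have Ti : (T <= i)%N by rewrite -ltnS -(ltr_nat R) (lt_trans xT).
have im : (i < m0 + m)%N by rewrite -(ltr_nat R) natrD (le_lt_trans ix).
have FE j d : `|x - j%:R| <= d.+1%:R ->
    F j <= (1 - expR (- h) ^+ d.+1) / (1 + expR (- h) ^+ d.+1).
  rewrite ler_norml => /andP[d1 d2].
  apply: blaschke_factor_le; rewrite ?exprn_ge0 ?(ltW q0) //.
    rewrite -expRM_natr -{1}(lnK z0) -expRD ler_expR.
    have : (x - j%:R) * h <= d.+1%:R * h by rewrite ler_pM2r.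
    by rewrite mulrBl xh; lra.
  rewrite -expRM_natr -[leRHS](lnK z0) -expRD ler_expR.
  have : - d.+1%:R * h <= (x - j%:R) * h by rewrite ler_pM2r.
  by rewrite mulrBl xh; lra.
pose G d := (1 - expR (- h) ^+ d.+1) / (1 + expR (- h) ^+ d.+1).
have F0 j : 0 <= F j by case/andP: (F01 j).
have right : \prod_(i.+1 <= j < i.+1 + T) F j <= \prod_(0 <= d < T) G d.
  rewrite -{1}[i.+1]add0n big_addn addKn; apply: ler_prod => d _.
  rewrite F0 /=; apply: FE; rewrite ler_norml; apply/andP; split.
    by rewrite natrD -[i.+1%:R]natr1 -[d.+1%:R]natr1; lra.
  by rewrite natrD; have := ler0n R d; have := ler0n R d.+1; lra.
have idx (T' i' d' : nat) : (d' < T' -> T' <= i' ->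
    T' - d'.+1 + (i'.+1 - T') = i' - d')%N by clear; lia.
have left : \prod_(i.+1 - T <= j < i.+1) F j <= \prod_(0 <= d < T) G d.
  rewrite -{1}[(i.+1 - T)%N]add0n big_addn.
  have -> : (i.+1 - (i.+1 - T) = T)%N by rewrite subKn // leqW.
  rewrite big_nat_rev /= add0n big_nat_cond [leRHS]big_nat_cond.
  apply: ler_prod => d /andP[/andP[_ dT] _]; rewrite F0 /=.
  rewrite idx //; have di : (d <= i)%N by rewrite (leq_trans (ltnW dT)).
  apply: FE; rewrite natrB // ler_norml; apply/andP; split.
    by have := ler0n R d; have := ler0n R d.+1; lra.
  by move: xi; rewrite -[i.+1%:R]natr1 -[d.+1%:R]natr1; lra.
have hl : \prod_(0 <= d < T) G d <= expR (- (2 * (expR (- h) ^+ (2 * K) *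
    (1 - expR (- h) ^+ T) / h) * \sum_(0 <= k < K) (2 * k%:R + 1) ^- 2)).
  exact: prod_moebius_le.
have E0 m1 n1 : 0 <= \prod_(m1 <= j < n1) F j by apply: prodr_ge0.
rewrite -[iota 0 _]/(index_iota 0 (2 * m).+1).
apply: (@le_trans _ _ (\prod_(i.+1 - T <= j < i.+1 + T) F j)).
  apply: prod_sub_nat_le => //.
    by rewrite (leq_trans (leq_subr _ _)) // leq_addr.
  by move: im; rewrite /m; clear; lia.
rewrite (@big_cat_nat _ _ _ i.+1) ?leq_subr ?leq_addr //=.
have -> (a s : R) : - (4 * a * s) = - (2 * a * s) + - (2 * a * s) by ring.
rewrite expRD; apply: ler_pM => //; first exact: le_trans left hl.
exact: le_trans right hl.
Qed.

(* The rate of Zolotarev's problem on [[kappa, 1 / kappa]]; the value to be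
   reached is [theta = pi^2 / 4] with [C = 0]. *)
Definition blaschke_rate (R : realType) (theta C : R) : Prop :=
  forall kappa : R, 0 < kappa < 1 -> exists2 c : seq R, (0 < size c)%N &
    blaschke_le c kappa (expR (- ((size c)%:R * theta / (ln (2 / kappa) + C)))).

Lemma blaschke_le_trans (R : realType) (c : seq R) (kappa M N : R) :
  M <= N -> blaschke_le c kappa M -> blaschke_le c kappa N.
Proof. by move=> MN [cpos cM]; split=> // z /cM /le_trans; apply. Qed.

Lemma ln2_div_gt0 (R : realType) (kappa : R) : 0 < kappa < 1 ->
  0 < ln (2 / kappa).
Proof. by move=> /andP[k0 k1]; rewrite ln_gt0 // ltr_pdivlMr //; lra. Qed.

(* The Landen map leads from some [z >= kappa^2 / 2] to [kappa], and
   [ln (2 / z) <= 2 ln (2 / kappa)]. *)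
Lemma blaschke_rate_half (R : realType) (theta C : R) : 0 <= theta -> 0 <= C ->
  blaschke_rate theta C -> blaschke_rate theta (C / 2).
Proof.
move=> t0 C0 H kappa k01; have /andP[k0 k1] := k01.
have kk : 0 < kappa ^+ 2 < 1 by rewrite exprn_gt0 // expr_lt1 // ltW.
have /andP[kk0 kk1] := kk.
have k2 : 0 < kappa ^+ 2 / 2 < 1.
  by rewrite divr_gt0 //= ltr_pdivrMr // mul1r; lra.
have [|z /andP[kz z1] zE] := @landen_preimage R _ (kappa ^+ 2) k2.
  rewrite (ltW kk1) andbT (_ : 2 * _ = kappa ^+ 2); last by field.
  rewrite ltr_pdivrMr; last by rewrite addr_gt0 // exprn_gt0 // divr_gt0.
  by rewrite ltr_pMr // ltrDl exprn_gt0 // divr_gt0.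
have z0 : 0 < z by apply: lt_trans kz; case/andP: k2.
have z01 : 0 < z < 1.
  rewrite z0 lt_neqAle z1 andbT; apply/eqP => zz; move: zE kk1.
  have two : (1 + 1 : R) = 2 by [].
  by rewrite zz mulr1 expr1n two divff // => ->; rewrite ltxx.
have [c c0 cM] := H z z01.
have [d sd dM] := blaschke_le_landen z01 k0 zE cM.
exists d; rewrite sd //; apply: blaschke_le_trans dM.
have l1 := ln2_div_gt0 z01; have l2 := ln2_div_gt0 k01.
rewrite -expRM_natr ler_expR mulNr lerN2 -[leRHS]mulrA.
rewrite ler_wpM2l ?mulr_ge0 //.
have h1 : 0 < ln (2 / kappa) + C / 2 by rewrite ltr_wpDr ?divr_ge0.
have h2 : 0 < ln (2 / z) + C by rewrite ltr_wpDr.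
rewrite -ler_pdivrMr // -invfM lef_pV2 ?posrE ?mulr_gt0 //.
have -> : (ln (2 / kappa) + C / 2) * 2 = ln (2 / kappa) *+ 2 + C.
  by rewrite mulrDl divfK // mulr_natr.
rewrite lerD2r -lnXn ?divr_gt0 // ler_ln ?posrE ?exprn_gt0 ?divr_gt0 //.
rewrite expr_div_n ler_pdivlMr // mulrC mulrA ler_pdivrMr //.
have : kappa ^+ 2 < z * 2 by rewrite -ltr_pdivrMr.
by rewrite (_ : 2 ^+ 2 = 2 * 2 :> R) ?expr2 //; lra.
Qed.

(** With [K = 2 ^ n], [h = K^-2] and [T = K^3] the relative losses in [expR (- h) ^+ (2 * K)], in
    [1 - expR (- h) ^+ T] and in the sum of inverse squares are at most [2 / K], [1 / K] and
    [1 / K], together [4 / K]. The price is a constant [C] of order [K], which [blaschke_rate_half]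
    removes. *)
Lemma blaschke_rate_base (R : realType) (n : nat) : (2 <= n)%N ->
  exists2 C : R, 0 <= C &
    blaschke_rate (pi ^+ 2 / 4 * (1 - 4 / 2 ^+ n)) C.
Proof.
move=> n2; pose K := (2 ^ n)%N.
have KE : K%:R = 2 ^+ n :> R by rewrite natrX.
have K4 : 4 <= K%:R :> R by rewrite ler_nat -[4%N]/(2 ^ 2)%N leq_exp2l.
have K0 : 0 < K%:R :> R by lra.
pose h : R := K%:R ^- 2; pose T := (K ^ 3)%N.
have h0 : 0 < h by rewrite invr_gt0 exprn_gt0.
exists ((T%:R + 3 / 2) * h) => [|kappa k01].
  by rewrite mulr_ge0 ?(ltW h0) // addr_ge0 // divr_ge0.
have [c [c0 cs cM]] := @geometric_blaschke_le R h kappa K T h0 k01.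
exists c => //; apply: blaschke_le_trans cM; rewrite ler_expR lerN2.
set S := \sum_(_ <= _ < _) _; set a := expR _ ^+ _ * _.
have /andP[k0 k1] := k01.
have pi0 : 0 < pi ^+ 2 :> R by rewrite exprn_gt0 // pi_gt0.
have SE : pi ^+ 2 / 8 * (1 - 1 / K%:R) <= S.
  apply: le_trans (sum_odd_inv_sqr_ge R n); rewrite -KE.
  have : 0 <= pi ^+ 2 / (16 * K%:R) :> R by rewrite divr_ge0 ?ltW // mulr_gt0.
  have -> : pi ^+ 2 / (16 * K%:R) = pi ^+ 2 / 8 * (1 / K%:R) / 2 :> R.
    by move: (lt0r_neq0 K0); move: (K%:R) => x x0; field.
  by lra.
have K01 : 0 < 1 / (K%:R : R) <= 4^-1.
  by rewrite divr_gt0 //= ler_pdivrMr // ler_pdivlMl //; lra.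
have /andP[iK0 iK4] := K01; set u : R := 1 / K%:R in SE K01 iK0 iK4 *.
have uE : 4 / 2 ^+ n = 4 * u :> R by rewrite -KE /u mul1r.
have aE : (1 - 2 * u) * (1 - u) <= a.
  apply: ler_pM; rewrite ?subr_ge0; try lra.
    rewrite -expRM_natr; apply: le_trans (expR_ge1Dx _).
    rewrite lerD2l mulNr lerN2 /h /u natrM le_eqVlt; apply/orP; left; apply/eqP.
    by move: (lt0r_neq0 K0); move: (K%:R) => x x0; field.
  rewrite lerD2l lerN2 -expRM_natr mulNr expRN.
  have -> : h * T%:R = K%:R.
    by rewrite /h /T natrX; move: (lt0r_neq0 K0); move: (K%:R) => x x0; field.
  rewrite /u div1r lef_pV2 ?posrE ?expR_gt0 //.
  by have := expR_ge1Dx (K%:R : R); lra.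
have aS : pi ^+ 2 / 8 * (1 - 4 * u) <= a * S.
  apply: (@le_trans _ _ ((1 - 2 * u) * (1 - u) * (pi ^+ 2 / 8 * (1 - u)))).
    rewrite [leRHS]mulrCA ler_pM2l ?divr_gt0 //.
    have : 0 <= 5 * u ^+ 2 - 2 * u ^+ 3.
      have -> : 5 * u ^+ 2 - 2 * u ^+ 3 = u ^+ 2 * (5 - 2 * u) by ring.
      by rewrite mulr_ge0 ?sqr_ge0 //; lra.
    by lra.
  apply: ler_pM => //; first by rewrite mulr_ge0 //; lra.
  by rewrite mulr_ge0 ?divr_ge0 ?(ltW pi0) //; lra.
set Lk := ln (2 / kappa) + _.
have LkE : (size c)%:R * h <= 2 * Lk.
  apply: le_trans cs _; rewrite /Lk mulrDr.
  have : ln kappa^-1 <= ln (2 / kappa).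
    rewrite ler_ln ?posrE ?invr_gt0 ?divr_gt0 // ler_peMl ?invr_ge0 ?(ltW k0) //.
    by lra.
  by lra.
have Lk0 : 0 < Lk.
  by rewrite /Lk ltr_wpDr ?ln2_div_gt0 // mulr_ge0 ?addr_ge0 ?divr_ge0 // ltW.
have th0 : 0 <= pi ^+ 2 / 4 * (1 - 4 * u) by rewrite mulr_ge0 ?divr_ge0 ?(ltW pi0) //; lra.
rewrite uE ler_pdivrMr //.
apply: (@le_trans _ _ (2 * Lk / h * (pi ^+ 2 / 4 * (1 - 4 * u)))).
  by apply: ler_wpM2r => //; rewrite ler_pdivlMr.
have -> : 4 * (a / h) * S * Lk = (Lk / h) * (4 * (a * S)) by ring.
have -> : 2 * Lk / h * (pi ^+ 2 / 4 * (1 - 4 * u)) =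
  (Lk / h) * (4 * (pi ^+ 2 / 8 * (1 - 4 * u))) by field; rewrite gt_eqF.
by rewrite ler_pM2l ?divr_gt0 // ler_pM2l.
Qed.

Lemma le_of_le_expn2V (R : realType) (x y c : R) :
  (forall n, x <= y + c / 2 ^+ n) -> x <= y.
Proof.
move=> H; apply/ler_addgt0Pr => e e0.
have [c0|c0] := leP c 0.
  apply: (le_trans (H 0)); rewrite expr0 divr1; lra.
pose n := (Num.truncn (c / e)).+1.
apply: (le_trans (H n)); rewrite lerD2l ler_pdivrMr ?exprn_gt0 //.
rewrite mulrC -ler_pdivrMr //; apply: (@le_trans _ _ n%:R).
  by apply/ltW/truncnS_gt.
by rewrite -natrX ler_nat ltnW // ltn_expl.
Qed.

(** The last hypothesis is what [blaschke_pushforward] and [blaschke_lower] give together. The root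
    of order [size c] turns a rate into [l%:R * theta <= t * (L + C)]; then [C] is halved away, and
    finally [theta] tends to [pi ^+ 2 / 4]. *)
Lemma degree_bound_of_pushforward (R : realType) (l : nat) (kappa eps : R) :
  0 < kappa < 1 -> 0 < eps < 1 ->
  (forall c M, blaschke_le c kappa M -> (eps / 2) ^+ size c <= M ^+ l) ->
  eps ^+ 2 <= 4 * expR (- (l%:R * pi ^+ 2 / (2 * ln (2 / kappa)))).
Proof.
move=> k01 /andP[e0 e1] H.
set L := ln (2 / kappa); have L0 : 0 < L by apply: ln2_div_gt0.
have e2 : 0 < eps / 2 by rewrite divr_gt0.
set t := - ln (eps / 2).
have step theta C : 0 <= C -> blaschke_rate theta C -> l%:R * theta <= t * (L + C).
  move=> C0 /(_ kappa k01)[c c0 cM].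
  have LC : 0 < L + C by lra.
  have := H _ _ cM; rewrite -/L -expRM_natr.
  have -> : - ((size c)%:R * theta / (L + C)) * l%:R =
    - (l%:R * theta / (L + C)) * (size c)%:R by ring.
  rewrite expRM_natr ler_pXn2r ?nnegrE ?expR_ge0 ?(ltW e2) // => h.
  rewrite -ler_pdivrMr // -lerN2 /t opprK -[leRHS]expRK ler_ln ?posrE ?expR_gt0 //.
have {}step theta C : 0 <= theta -> 0 <= C -> blaschke_rate theta C ->
    l%:R * theta <= t * L.
  move=> th0 C0 rate; apply: (@le_of_le_expn2V _ _ _ (t * C)) => k.
  rewrite -mulrA -mulrDr; apply: step; first by rewrite divr_ge0 // exprn_ge0.
  elim: k => [|k IH]; first by rewrite expr0 divr1.
  rewrite exprSr invfM mulrA; apply: blaschke_rate_half => //.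
  by rewrite divr_ge0 // exprn_ge0.
have {}step : l%:R * (pi ^+ 2 / 4) <= t * L.
  apply: (@le_of_le_expn2V _ _ _ (l%:R * pi ^+ 2 / 4)) => n.
  have [C C0] := @blaschke_rate_base R n.+2 isT.
  have th0 : 0 <= pi ^+ 2 / 4 * (1 - 4 / 2 ^+ n.+2) :> R.
    rewrite mulr_ge0 ?divr_ge0 ?sqr_ge0 // subr_ge0 ler_pdivrMr ?exprn_gt0 // mul1r.
    by rewrite -natrX ler_nat -[4%N]/(2 ^ 2)%N leq_exp2l.
  move=> /(step _ _ th0 C0) h; rewrite -lerBlDr; apply: le_trans h.
  rewrite le_eqVlt; apply/orP; left; apply/eqP.
  by rewrite !exprS; field; rewrite expf_neq0.
have -> : eps ^+ 2 = 4 * (eps / 2) ^+ 2 by field.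
rewrite ler_pM2l // -{1}(lnK (e2 : eps / 2 \is Num.pos)) -expRM_natr ler_expR.
have tE : ln (eps / 2) = - t by rewrite opprK.
rewrite tE mulNr lerN2 ler_pdivrMr ?mulr_gt0 //.
by lra.
Qed.
(** * Pushforward along an equioscillating function *)

Definition blaschke_num (R : realType) (ps : seq R) : {poly R} :=
  \prod_(p <- ps) ('X - p%:P).

(** Written with [- p] as a root, so that the facts on products of factors ['X - c%:P] apply. *)
Definition blaschke_den (R : realType) (ps : seq R) : {poly R} :=
  \prod_(p <- ps) ('X - (- p)%:P).

Lemma horner_blaschke_num (R : realType) (ps : seq R) (z : R) :
  (blaschke_num ps).[z] = \prod_(p <- ps) (z - p).
Proof. by rewrite horner_prod; apply: eq_bigr => p _; rewrite !hornerE. Qed.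

Lemma horner_blaschke_den (R : realType) (ps : seq R) (z : R) :
  (blaschke_den ps).[z] = \prod_(p <- ps) (z + p).
Proof. by rewrite horner_prod; apply: eq_bigr => p _; rewrite !hornerE opprK. Qed.

Lemma prod_oppr (R : comNzRingType) (T : Type) (s : seq T) (F : T -> R) :
  \prod_(i <- s) (- F i) = (-1) ^+ size s * \prod_(i <- s) F i.
Proof.
elim: s => [|i s IH]; first by rewrite !big_nil mulr1.
by rewrite !big_cons IH exprS; ring.
Qed.

Lemma blaschke_num_opp (R : realType) (ps : seq R) (z : R) :
  (blaschke_num ps).[- z] = (-1) ^+ size ps * (blaschke_den ps).[z].
Proof.
rewrite horner_blaschke_num horner_blaschke_den -prod_oppr.
by apply: eq_bigr => p _; ring.
Qed.

Lemma blaschke_den_opp (R : realType) (ps : seq R) (z : R) :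
  (blaschke_den ps).[- z] = (-1) ^+ size ps * (blaschke_num ps).[z].
Proof.
rewrite horner_blaschke_num horner_blaschke_den -prod_oppr.
by apply: eq_bigr => p _; ring.
Qed.

Lemma blaschke_den_gt0 (R : realType) (ps : seq R) (z : R) : 0 < z ->
  {in ps, forall p, 0 < p} -> 0 < (blaschke_den ps).[z].
Proof.
move=> z0 pos; rewrite horner_blaschke_den big_seq.
by apply: prodr_gt0 => p /pos p0; rewrite addr_gt0.
Qed.

Lemma blaschkeE (R : realType) (ps : seq R) (z : R) :
  blaschke ps z = `|(blaschke_num ps).[z]| / (blaschke_den ps).[z].
Proof.
by rewrite horner_blaschke_num horner_blaschke_den normr_prod /blaschke prodf_div.
Qed.

Lemma blaschke_frac_lt1 (R : realType) (ps : seq R) (z : R) : (0 < size ps)%N ->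
  0 < z -> {in ps, forall p, 0 < p} ->
  `|(blaschke_num ps).[z] / (blaschke_den ps).[z]| < 1.
Proof.
move=> s0 z0 pos; rewrite normrM normfV.
rewrite (gtr0_norm (blaschke_den_gt0 z0 pos)) -blaschkeE.
case: ps s0 pos => // p ps _ pos; rewrite blaschke_cons.
have p0 : 0 < p by apply: pos; rewrite mem_head.
have /andP[h1 h2] : 0 <= blaschke ps z <= 1.
  by apply: blaschke_itv01 => // q qp; apply: pos; rewrite inE qp orbT.
apply: (@le_lt_trans _ _ (`|z - p| / (z + p))).
  by rewrite ler_piMr // divr_ge0 // addr_ge0 ?ltW.
rewrite ltr_pdivrMr ?addr_gt0 // mul1r ltr_norml.
by apply/andP; split; lra.
Qed.

(* The [j]-th point lies between the [j]-th and the [j+1]-st smallest zero. *)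
Definition equioscillates (R : realType) (ps : seq R) (z : nat -> R)
  (alpha eps : R) : Prop :=
  forall j, (j <= size ps)%N ->
  [/\ alpha <= z j <= 1, blaschke ps (z j) = eps,
      forall i, (i < j)%N -> nth 0 ps i <= z j &
      forall i, (j <= i < size ps)%N -> z j <= nth 0 ps i].

Lemma sign_blaschke_num (R : realType) (ps : seq R) (j : nat) (z : R) :
  (j <= size ps)%N ->
  (forall i, (i < j)%N -> nth 0 ps i <= z) ->
  (forall i, (j <= i < size ps)%N -> z <= nth 0 ps i) ->
  (-1) ^+ (size ps - j) * (blaschke_num ps).[z] = `|(blaschke_num ps).[z]|.
Proof.
move=> jn lo hi; rewrite horner_blaschke_num normr_prod.
rewrite [in LHS](big_nth 0) [RHS](big_nth 0).
rewrite [in LHS](@big_cat_nat _ _ _ j) // [RHS](@big_cat_nat _ _ _ j) //=.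
have -> : \prod_(0 <= i < j) `|z - nth 0 ps i| = \prod_(0 <= i < j) (z - nth 0 ps i).
  apply: eq_big_nat => i /andP[_ ij].
  by rewrite ger0_norm // subr_ge0 lo.
have -> : \prod_(j <= i < size ps) `|z - nth 0 ps i|
    = (-1) ^+ (size ps - j) * \prod_(j <= i < size ps) (z - nth 0 ps i).
  rewrite -{1}(size_iota j (size ps - j)) -prod_oppr.
  apply: eq_big_nat => i ij.
  by rewrite ler0_norm // subr_le0 hi.
by rewrite mulrCA.
Qed.

(** At the points [z j] the quotient of the two polynomials equals [eps] up to an alternating sign,
    so it takes the value [tau] between any two neighbours. This gives as many roots as the degree,
    and the leading coefficient is [1 - tau]. *)
Lemma blaschke_preimages (R : realType) (ps : seq R) (z : nat -> R)
  (alpha eps tau : R) : 0 < alpha -> 0 < eps < 1 ->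
  {in ps, forall p, 0 < p} -> equioscillates ps z alpha eps -> `|tau| < eps ->
  exists2 ts : seq R, size ts = size ps /\ {in ts, forall t, alpha < t < 1} &
    blaschke_num ps - tau *: blaschke_den ps
      = (1 - tau) *: \prod_(t <- ts) ('X - t%:P).
Proof.
move=> a0 /andP[e0 e1] pos eq tau_eps; set n := size ps.
have tau1 : tau < 1 by rewrite (le_lt_trans (ler_norm _)) // (lt_trans tau_eps).
set q := blaschke_num ps - tau *: blaschke_den ps.
have zpos j : (j <= n)%N -> 0 < z j.
  by move=> /eq[/andP[h _] _ _ _]; exact: lt_le_trans h.
have sq j : (j <= n)%N -> 0 < (-1) ^+ (n - j) * q.[z j].
  move=> jn; have [_ bz lo hi] := eq j jn.
  have h0 := blaschke_den_gt0 (zpos j jn) pos.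
  rewrite /q !hornerE mulrDr mulrN sign_blaschke_num //.
  have -> : `|(blaschke_num ps).[z j]| = eps * (blaschke_den ps).[z j].
    by rewrite -bz blaschkeE divfK // gt_eqF.
  rewrite mulrA -mulrBl mulr_gt0 // subr_gt0.
  apply: le_lt_trans tau_eps; apply: le_trans (ler_norm _) _.
  by rewrite normrM normrX normrN1 expr1n mul1r.
have zle i j : (i < j)%N -> (j <= n)%N -> z i <= z j.
  move=> ij jn; have iltn := leq_trans ij jn.
  have [_ _ _ hi] := eq i (ltnW iltn); have [_ _ lo _] := eq j jn.
  by apply: (le_trans (hi i _)); [rewrite leqnn|exact: lo].
have root_ex (j : 'I_n) : exists t, z j < t < z j.+1 /\ root q t.
  have jn := ltn_ord j.
  have [|t] := @polyrcf.poly_ivtoo R q (z j) (z j.+1) (zle j j.+1 (leqnn _) jn).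
    have := sq j (ltnW jn); have := sq j.+1 jn.
    rewrite -(subnSK jn) exprS.
    move=> h1 h2; have := mulr_gt0 h1 h2.
    have -> : (-1) ^+ (n - j.+1) * q.[z j.+1] * (-1 * (-1) ^+ (n - j.+1) * q.[z j])
      = - (((-1) ^+ (n - j.+1)) ^+ 2) * (q.[z j] * q.[z j.+1]) by ring.
    by rewrite sqrr_sign mulN1r oppr_gt0.
  by rewrite in_itv /= => h1 h2; exists t.
have [t tP] := choice root_ex.
pose ts := [seq t j | j <- enum 'I_n].
have sts : size ts = n by rewrite size_map size_enum_ord.
have tlt (i j : 'I_n) : (i < j)%N -> t i < t j.
  move=> ij; have [/andP[_ h1] _] := tP i; have [/andP[h2 _] _] := tP j.
  apply: (lt_trans h1); apply: le_lt_trans h2.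
  have [->//|h] := eqVneq i.+1 (j : nat).
  by apply: zle; [rewrite ltn_neqAle h|exact/ltnW].
have tinj : injective t.
  move=> i j tij; apply/val_inj.
  by case: (ltngtP i j) => // /tlt; rewrite tij ltxx.
exists ts.
  split=> // _ /mapP[j _ ->]; have [/andP[h1 h2] _] := tP j.
  have [/andP[h3 _] _ _ _] := eq j (ltnW (ltn_ord j)).
  have [/andP[_ h4] _ _ _] := eq j.+1 (ltn_ord j).
  by rewrite (le_lt_trans h3 h1) (lt_le_trans h2 h4).
have sg : size (blaschke_num ps) = n.+1 by rewrite size_prod_XsubC.
have sh : size (blaschke_den ps) = n.+1 by rewrite size_prod_XsubC.
have cq : q`_n = 1 - tau.
  rewrite /q coefB coefZ.
  have -> : (blaschke_num ps)`_n = 1.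
    by have := lead_coef_prod_XsubC ps predT id; rewrite lead_coefE sg.
  have -> : (blaschke_den ps)`_n = 1.
    by have := lead_coef_prod_XsubC ps predT -%R; rewrite lead_coefE sh.
  by rewrite mulr1.
have sqn : size q = n.+1.
  apply/eqP; rewrite eqn_leq; apply/andP; split.
    rewrite (leq_trans (size_polyD _ _)) // size_polyN geq_max sg leqnn /=.
    by rewrite (leq_trans (size_scale_leq _ _)) // sh.
  by rewrite ltnNge; apply/negP => /leq_sizeP /(_ n (leqnn _)); rewrite cq; lra.
rewrite -cq; have -> : q`_n = lead_coef q by rewrite lead_coefE sqn.
apply: all_roots_prod_XsubC; first by rewrite sqn sts.
  by apply/allP => _ /mapP[j _ ->]; have [] := tP j.
by rewrite uniq_rootsE map_inj_uniq // enum_uniq.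
Qed.

(* Multiplying [blaschke cs] over the [l] preimages of a point under the
   degree-[l] map [(1 - r) / (1 + r)] is again of the form [blaschke ds]. *)
Lemma blaschke_pushforward (R : realType) (ps cs : seq R) (z : nat -> R)
  (alpha eps M : R) : (0 < size ps)%N -> 0 < alpha -> 0 < eps < 1 ->
  {in ps, forall p, 0 < p} -> equioscillates ps z alpha eps ->
  {in cs, forall p, 0 < p} -> (forall x, alpha < x < 1 -> blaschke cs x <= M) ->
  exists2 ds, size ds = size cs &
    blaschke_le ds ((1 - eps) / (1 + eps)) (M ^+ size ps).
Proof.
move=> s0 a0 e01 pos eq cpos cM; have /andP[e0 e1] := e01.
pose sg c := (blaschke_num ps).[c] / (blaschke_den ps).[c].
have sg1 c : c \in cs -> -1 < sg c < 1.
  by move=> /cpos c0; rewrite -ltr_norml; apply: blaschke_frac_lt1.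
(* The quotient [r] satisfies [r(- z) = 1 / r(z)], and the Cayley transform turns reciprocals into
   opposites: [(1 - r) / (1 + r)] is odd. So the images of the zero [c] and of the pole [- c] are
   again opposite. *)
exists [seq (1 - sg c) / (1 + sg c) | c <- cs]; first by rewrite size_map.
split=> [_ /mapP[c /sg1 /andP[h1 h2] ->]|w /andP[kw wk]].
  by rewrite divr_gt0 //; lra.
have w0 : 0 < w by apply: lt_trans kw; rewrite divr_gt0; lra.
have h1e : 0 < 1 + eps by lra.
move: kw wk; rewrite ltr_pdivrMr // => kw; rewrite invf_div ltr_pdivlMr ?subr_gt0 // => wk.
pose tau := (1 - w) / (1 + w).
have w1 : 0 < 1 + w by lra.
have tau_eps : `|tau| < eps.
  rewrite /tau normrM normfV (gtr0_norm w1) ltr_pdivrMr // ltr_norml.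
  by apply/andP; split; lra.
have [ts [sts tsa] qE] := blaschke_preimages a0 e01 pos eq tau_eps.
rewrite -sts; apply: (@le_trans _ _ (\prod_(t <- ts) blaschke cs t)); last first.
  have {}tsa t : t \in ts -> 0 <= blaschke cs t <= M.
    move=> /tsa ta; rewrite cM // andbT blaschke_ge0 //.
    by case/andP: ta => /(lt_trans a0).
  elim: (ts) tsa => [|t s IH] H; first by rewrite big_nil.
  rewrite big_cons exprS; have /andP[H1 H2] := H t (mem_head _ _).
  have {}H u : u \in s -> 0 <= blaschke cs u <= M.
    by move=> us; apply: H; rewrite inE us orbT.
  apply: ler_pM => //; last exact: IH.
  by rewrite big_seq; apply: prodr_ge0 => u /H /andP[].
rewrite /blaschke big_map exchange_big /= le_eqVlt; apply/orP; left; apply/eqP.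
rewrite big_seq [RHS]big_seq; apply: eq_bigr => c ccs.
have c0 := cpos c ccs; have /andP[s1 s2] := sg1 c ccs.
have hc := blaschke_den_gt0 c0 pos.
have tau1 : 1 - tau != 0.
  rewrite /tau (_ : 1 - _ = 2 * w / (1 + w)); last by field; rewrite gt_eqF.
  by rewrite gt_eqF // divr_gt0 // mulr_gt0.
(* The factorization over the preimages, evaluated at [c], collects all numerators; evaluated at
   [- c], it collects all denominators. *)
have E1 : `|(blaschke_num ps).[c] - tau * (blaschke_den ps).[c]|
    = `|1 - tau| * \prod_(t <- ts) `|t - c|.
  have := congr1 (fun p => `|p.[c]|) qE; rewrite !hornerE => ->.
  rewrite normrM horner_prod normr_prod; congr (_ * _); apply: eq_bigr => t _.
  by rewrite !hornerE distrC.
have E2 : `|(blaschke_den ps).[c] - tau * (blaschke_num ps).[c]|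
    = `|1 - tau| * \prod_(t <- ts) (t + c).
  have := congr1 (fun p => `|p.[- c]|) qE; rewrite !hornerE.
  rewrite blaschke_num_opp blaschke_den_opp mulrCA -mulrBr normrM.
  rewrite normrX normrN1 expr1n mul1r => ->.
  rewrite normrM horner_prod normr_prod; congr (_ * _); apply: eq_big_seq => t /tsa.
  move=> /andP[t0 _]; rewrite !hornerE -opprD normrN addrC ger0_norm //.
  by rewrite addr_ge0 ?(ltW c0) // ltW // (lt_trans a0).
rewrite prodf_div.
have -> : \prod_(t <- ts) `|t - c| / \prod_(t <- ts) (t + c) =
   (`|1 - tau| * \prod_(t <- ts) `|t - c|) / (`|1 - tau| * \prod_(t <- ts) (t + c)).
  by rewrite -mulf_div divff ?mul1r // normr_eq0.
rewrite -E1 -E2.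
have -> : (blaschke_num ps).[c] - tau * (blaschke_den ps).[c]
    = (sg c - tau) * (blaschke_den ps).[c].
  by rewrite mulrBl divfK // gt_eqF.
have -> : (blaschke_den ps).[c] - tau * (blaschke_num ps).[c]
    = (1 - tau * sg c) * (blaschke_den ps).[c].
  by rewrite mulrBl mul1r -mulrA divfK // gt_eqF.
rewrite !normrM -mulf_div divff ?mulr1; last by rewrite normr_eq0 gt_eqF.
have s1' : 0 < 1 + sg c by lra.
have D : 0 < 1 - tau * sg c.
  have : `|tau * sg c| < 1.
    rewrite normrM -[1]mul1r; apply: ltr_pM => //; first exact: lt_trans e1.
    by rewrite ltr_norml s1.
  by have := ler_norm (tau * sg c); lra.
rewrite (gtr0_norm D).
have -> : w - (1 - sg c) / (1 + sg c) = 2 * (sg c - tau) / ((1 + sg c) * (1 + tau)).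
  rewrite /tau (_ : 1 + (1 - w) / (1 + w) = 2 / (1 + w)); last by field; rewrite gt_eqF.
  by field; rewrite !gt_eqF.
have -> : w + (1 - sg c) / (1 + sg c) = 2 * (1 - tau * sg c) / ((1 + sg c) * (1 + tau)).
  rewrite /tau (_ : 1 + (1 - w) / (1 + w) = 2 / (1 + w)); last by field; rewrite gt_eqF.
  by field; rewrite !gt_eqF.
have t1 : 0 < 1 + tau.
  rewrite /tau (_ : 1 + (1 - w) / (1 + w) = 2 / (1 + w)); last by field; rewrite gt_eqF.
  by rewrite divr_gt0.
have P0 : 0 < (1 + sg c) * (1 + tau) by rewrite mulr_gt0.
rewrite normrM normfV (gtr0_norm P0) normrM gtr0_norm //.
by field; rewrite !gt_eqF.
Qed.

(** Division by [k = Num.sqrt alpha] takes [[alpha, 1]] to [[k, k^-1]], which is symmetric under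
    inversion; accordingly [ln (4 / alpha) = 2 * ln (2 / k)]. *)
Lemma equioscillation_bound (R : realType) (ps : seq R) (z : nat -> R)
  (alpha eps : R) : (0 < size ps)%N -> 0 < alpha < 1 -> 0 < eps < 1 ->
  {in ps, forall p, 0 < p} -> equioscillates ps z alpha eps ->
  eps ^+ 2 <= 4 * expR (- ((size ps)%:R * pi ^+ 2 / ln (4 / alpha))).
Proof.
move=> s0 /andP[a0 a1] e01 pos eq.
set k := Num.sqrt alpha.
have k0 : 0 < k by rewrite sqrtr_gt0.
have kk : k ^+ 2 = alpha by rewrite sqr_sqrtr // ltW.
have k1 : k < 1 by rewrite -[1]sqrtr1 ltr_sqrt.
have -> : ln (4 / alpha) = 2 * ln (2 / k).
  have -> : 4 / alpha = (2 / k) ^+ 2.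
    by rewrite -kk expr_div_n (_ : 2 ^+ 2 = 4 :> R) // -natrX.
  by rewrite lnXn ?divr_gt0 // [RHS]mulr_natl.
apply: degree_bound_of_pushforward => //; first by rewrite k0.
move=> c M [cpos cM].
have [_ /mapP[p /cpos p0 ->]|x /andP[x0 x1]|ds sds dM] :=
  @blaschke_pushforward R ps [seq k * p | p <- c] z alpha eps M s0 a0 e01 pos eq.
- by rewrite mulr_gt0.
- have -> : x = k * (k^-1 * x) by rewrite mulVKf // gt_eqF.
  rewrite blaschke_scale //; apply: cM.
  rewrite ltr_pdivlMl // -expr2 kk x0 /= -[ltRHS]mulr1 ltr_pM2l ?invr_gt0 //.
- by rewrite size_map in sds; rewrite -sds; apply: blaschke_lower dM.
Qed.
(** * Equioscillation of the minimizer *)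

Lemma blaschke_continuous (R : realType) (c : seq R) (z : R) : 0 < z ->
  {in c, forall p, 0 < p} -> {for z, continuous (blaschke c)}.
Proof.
move=> z0; elim: c => [|p c IH] pos.
  rewrite (_ : blaschke [::] = cst 1); first exact: cst_continuous.
  by apply/funext => x; rewrite blaschke_nil.
rewrite (_ : blaschke (p :: c) = (fun x => `|x - p| / (x + p) * blaschke c x));
  last by apply/funext => x; rewrite blaschke_cons.
apply: (@continuousM R R (fun x => `|x - p| / (x + p)) (blaschke c)); last first.
  by apply: IH => q qc; apply: pos; rewrite inE qc orbT.
have p0 : 0 < p by apply: pos; rewrite mem_head.
apply: (@continuousM R R (fun x => `|x - p|) (fun x => (x + p)^-1)).
  apply: (@continuous_comp _ _ _ (fun x : R => x - p) Num.norm).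
    by apply: (@continuousB R R R id (cst p)); [exact: cvg_id|exact: cvg_cst].
  exact: norm_continuous.
apply: (@continuousV R R (fun x => x + p)); first by rewrite gt_eqF // addr_gt0.
by apply: (@continuousD R R R id (cst p)); [exact: cvg_id|exact: cvg_cst].
Qed.

Lemma blaschke_max (R : realType) (c : seq R) (u v : R) : 0 < u -> u <= v ->
  {in c, forall p, 0 < p} ->
  exists2 w, u <= w <= v & forall z, u <= z <= v -> blaschke c z <= blaschke c w.
Proof.
move=> u0 uv pos; have [|w] := @EVT_max R (blaschke c) u v uv.
  apply: continuous_in_subspaceT => x; rewrite inE /= in_itv /= => /andP[ux _].
  by apply: blaschke_continuous => //; exact: lt_le_trans ux.
by rewrite in_itv /= => wuv H; exists w => // z zuv; apply: H; rewrite in_itv.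
Qed.

(** The competitors may have zeros outside [[alpha, 1]], since the displaced zeros of the
    perturbation argument may leave that interval. *)
Definition minimax (R : realType) (alpha : R) (ps : seq R) (eps : R) : Prop :=
  (forall z, alpha <= z <= 1 -> blaschke ps z <= eps) /\
  forall qs, size qs = size ps -> {in qs, forall p, 0 < p} ->
    exists2 z, alpha <= z <= 1 & eps <= blaschke qs z.

(* If [blaschke ps < eps] between two adjacent zeros, pushing them apart improves
   [ps] elsewhere; [t] is the size of the displacement. *)
Lemma minimax_attained (R : realType) (alpha eps u v : R) (ps : seq R) :
  0 < alpha -> 0 < eps <= 1 -> {in ps, forall p, 0 < p} ->
  minimax alpha ps eps -> alpha <= u -> u <= v -> v <= 1 ->
  (forall t, 0 < t <= 1 -> exists qs, [/\ size qs = size ps,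
     {in qs, forall p, 0 < p},
     forall z, u <= z <= v -> blaschke qs z <= blaschke ps z + 8 * t &
     forall z, alpha <= z <= 1 -> ~~ (u <= z <= v) ->
       blaschke qs z <= t \/ blaschke qs z < blaschke ps z]) ->
  exists2 z, u <= z <= v & blaschke ps z = eps.
Proof.
move=> a0 /andP[e0 e1] pos [psle opt] au uv v1 H.
have u0 : 0 < u := lt_le_trans a0 au.
have [w wuv wmax] := blaschke_max u0 uv pos.
have /andP[uw wv] := wuv.
exists w => //; apply/eqP; rewrite eq_le psle ?(le_trans au) ?(le_trans wv) //=.
rewrite leNgt; apply/negP => we.
have w0 : 0 <= blaschke ps w by apply: blaschke_ge0 => //; exact: lt_le_trans uw.
(* The increase [8 * t] then uses up half of the gap, and [t] itself is below [eps]. *)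
set t := (eps - blaschke ps w) / 16.
have t0 : 0 < t by rewrite divr_gt0 // subr_gt0.
have tE : 16 * t = eps - blaschke ps w by rewrite /t mulrC divfK.
have [|qs [sqs qpos qin qout]] := H t; first by rewrite t0 /=; lra.
have [z za] := opt qs sqs qpos; rewrite leNgt => /negP; apply.
have [zuv|zuv] := boolP (u <= z <= v).
  by apply: (le_lt_trans (qin z zuv)); have := wmax z zuv; lra.
have [h|h] := qout z za zuv; first by lra.
exact: lt_le_trans h (psle z za).
Qed.

Lemma blaschke_factor_lipschitz (R : realType) (z p q t : R) : 0 < z -> 0 < p ->
  0 < q -> `|p - q| <= t * q ->
  `|z - q| / (z + q) <= `|z - p| / (z + p) + 2 * t.
Proof.
move=> z0 p0 q0 pq.
have hp : 0 < z + p by rewrite addr_gt0.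
have hq : 0 < z + q by rewrite addr_gt0.
have t0 : 0 <= t by rewrite -(pmulr_lge0 _ q0) (le_trans _ pq).
rewrite ler_pdivrMr // mulrDl mulrAC -(ler_pM2r hp) mulrDl.
rewrite [X in _ <= X + _]divfK; last by rewrite gt_eqF.
have h1 : `|z - q| <= `|z - p| + `|p - q| by exact: ler_distD.
have h2 : `|z - p| <= z + p by rewrite ler_norml; apply/andP; split; lra.
have h3 : `|z - p| * (z + p) <= `|z - p| * (z + q) + `|p - q| * (z + p).
  have : `|z - p| * (p - q) <= `|z - p| * `|p - q|.
    by rewrite ler_wpM2l // ler_norm.
  have : `|z - p| * `|p - q| <= (z + p) * `|p - q| by rewrite ler_wpM2r.
  by lra.
have h4 : `|p - q| * (z + p) <= t * (z + q) * (z + p).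
  rewrite ler_pM2r // (le_trans pq) // ler_wpM2l //; lra.
have h5 : `|z - q| * (z + p) <= (`|z - p| + `|p - q|) * (z + p).
  by rewrite ler_pM2r.
by lra.
Qed.

Lemma blaschke_factor_near (R : realType) (z q t : R) : 0 < z -> 0 < q ->
  `|z - q| <= t * q -> `|z - q| / (z + q) <= t.
Proof.
move=> z0 q0 H; have t0 : 0 <= t by rewrite -(pmulr_lge0 _ q0) (le_trans _ H).
rewrite ler_pdivrMr ?addr_gt0 // (le_trans H) // ler_wpM2l //; lra.
Qed.

Lemma blaschke_factor_lt_right (R : realType) (z p q : R) : 0 < p -> p < q ->
  q <= z -> `|z - q| / (z + q) < `|z - p| / (z + p).
Proof.
move=> p0 pq qz; rewrite !ger0_norm ?subr_ge0 //; last by lra.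
have ? : 0 < z + q by lra.
have ? : 0 < z + p by lra.
rewrite ltr_pdivrMr // mulrAC ltr_pdivlMr //.
have : 0 < (q - p) * z by rewrite mulr_gt0; lra.
by lra.
Qed.

Lemma blaschke_factor_lt_left (R : realType) (z p q : R) : 0 < z -> q < p ->
  z <= q -> `|z - q| / (z + q) < `|z - p| / (z + p).
Proof.
move=> z0 qp zq; rewrite !(distrC z) !ger0_norm ?subr_ge0 //; last by lra.
have ? : 0 < z + q by lra.
have ? : 0 < z + p by lra.
rewrite ltr_pdivrMr // mulrAC ltr_pdivlMr //.
have : 0 < (p - q) * z by rewrite mulr_gt0; lra.
by lra.
Qed.

(* With A = z^2 + p p' and S = p + p', the product of the two factors is
   (A - z S) / (A + z S) up to sign, and moving the zeros apart increases S. *)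
Lemma blaschke_pair_lt (R : realType) (z p p' q q' : R) : 0 < z -> 0 < q ->
  0 < p -> p <= p' -> q * q' = p * p' -> q < p -> p' < q' ->
  (z <= q) || (q' <= z) ->
  `|z - q| / (z + q) * (`|z - q'| / (z + q'))
    < `|z - p| / (z + p) * (`|z - p'| / (z + p')).
Proof.
move=> z0 q0 p0 pp' E qp pq' out.
have p'0 : 0 < p' by lra.
have q'0 : 0 < q' by lra.
rewrite !mulf_div -!normrM.
have h1 : 0 <= (z - q) * (z - q').
  by case/orP: out => h; [rewrite mulr_le0|rewrite mulr_ge0];
    rewrite ?subr_le0 ?subr_ge0 //; lra.
have h2 : 0 <= (z - p) * (z - p').
  by case/orP: out => h; [rewrite mulr_le0|rewrite mulr_ge0];
    rewrite ?subr_le0 ?subr_ge0 //; lra.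
rewrite !ger0_norm //.
have k1 : 0 < (z + q) * (z + q') by rewrite mulr_gt0 // addr_gt0.
have k2 : 0 < (z + p) * (z + p') by rewrite mulr_gt0 // addr_gt0.
rewrite ltr_pdivrMr // mulrAC ltr_pdivlMr //.
have SS : p + p' < q + q'.
  rewrite -subr_gt0 -(pmulr_rgt0 _ q0).
  have -> : q * (q + q' - (p + p')) = (p - q) * (p' - q).
    have -> : q * (q + q' - (p + p')) = q * q' + q * (q - (p + p')) by ring.
    by rewrite E; ring.
  by rewrite mulr_gt0; lra.
have : 0 < 2 * z * (z ^+ 2 + p * p') * (q + q' - (p + p')).
  by rewrite mulr_gt0 ?subr_gt0 // mulr_gt0 ?mulr_gt0 // addr_gt0 ?mulr_gt0.
have -> : (z - q) * (z - q') = z ^+ 2 + p * p' - z * (q + q') by rewrite -E; ring.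
have -> : (z + q) * (z + q') = z ^+ 2 + p * p' + z * (q + q') by rewrite -E; ring.
by lra.
Qed.

(** The first alternative covers the points where the remaining factors vanish, so that lowering one
    factor gains nothing. *)
Lemma lt_or_eq0_mulr (R : realType) (x y r t : R) : 0 <= r -> 0 <= t -> x < y ->
  x * r <= t \/ x * r < y * r.
Proof.
rewrite le_eqVlt => /predU1P[<- t0 _|r0 _ xy]; first by left; rewrite mulr0.
by right; rewrite ltr_pM2r.
Qed.

(** Moving [p] to the right lowers the product beyond the new zero, and between the old and the new
    zero it is at most [t]. Only the points up to [p] can get worse, so [eps] is attained there. The
    next lemma is the mirror image. *)
Lemma minimax_gap_left (R : realType) (alpha eps : R) (ps r : seq R)
  (p : R) :
  0 < alpha -> 0 < eps <= 1 -> {in ps, forall p, 0 < p} ->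
  minimax alpha ps eps -> perm_eq ps (p :: r) ->
  alpha <= p <= 1 -> exists2 z, alpha <= z <= p & blaschke ps z = eps.
Proof.
move=> alpha_gt0 eps_itv ps_pos ps_opt psE /andP[ap p1].
have p0 : 0 < p := lt_le_trans alpha_gt0 ap.
have rpos : {in r, forall q, 0 < q}.
  by move=> q qr; apply: ps_pos; rewrite (perm_mem psE) inE qr orbT.
apply: minimax_attained ps_pos ps_opt _ _ _ _ => // t /andP[t0 t1].
have q0 : 0 < p * (1 + t) by rewrite mulr_gt0 //; lra.
have pq : p < p * (1 + t) by rewrite ltr_pMr //; lra.
have tq : t * p <= t * (p * (1 + t)) by rewrite ler_pM2l // ltW.
exists (p * (1 + t) :: r); split.
- by rewrite (perm_size psE).
- by move=> q; rewrite inE => /predU1P[->|/rpos].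
- move=> z /andP[az _]; have z0 : 0 < z := lt_le_trans alpha_gt0 az.
  rewrite (perm_blaschke z psE) !blaschke_cons.
  have := @blaschke_factor_lipschitz R z p _ t z0 p0 q0.
  have /andP[r0 r1] := blaschke_itv01 z0 rpos.
  have -> : `|p - p * (1 + t)| = t * p.
    by rewrite ler0_norm ?subr_le0 ?ltW //; ring.
  move=> /(_ tq) h; apply: (le_trans (ler_wpM2r r0 h)); rewrite mulrDl lerD2l.
  by apply: (@le_trans _ _ (2 * t)); [rewrite ler_piMr //|]; lra.
- move=> z /andP[az z1]; have z0 : 0 < z := lt_le_trans alpha_gt0 az.
  rewrite az /= -ltNge => pz; rewrite (perm_blaschke z psE) !blaschke_cons.
  have /andP[r0 r1] := blaschke_itv01 z0 rpos.
  have [qz|zq] := leP (p * (1 + t)) z.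
    by apply: lt_or_eq0_mulr => //; [exact: ltW|exact: blaschke_factor_lt_right].
  left; apply: (@le_trans _ _ (t * 1)); last by rewrite mulr1.
  apply: ler_pM => //; first by rewrite divr_ge0 // addr_ge0 ?(ltW z0) ?(ltW q0).
  apply: blaschke_factor_near => //; apply: le_trans tq.
  by rewrite ler0_norm; lra.
Qed.

Lemma minimax_gap_right (R : realType) (alpha eps : R) (ps r : seq R)
  (p : R) :
  0 < alpha -> 0 < eps <= 1 -> {in ps, forall p, 0 < p} ->
  minimax alpha ps eps -> perm_eq ps (p :: r) ->
  alpha <= p <= 1 -> exists2 z, p <= z <= 1 & blaschke ps z = eps.
Proof.
move=> alpha_gt0 eps_itv ps_pos ps_opt psE /andP[ap p1].
have p0 : 0 < p := lt_le_trans alpha_gt0 ap.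
have rpos : {in r, forall q, 0 < q}.
  by move=> q qr; apply: ps_pos; rewrite (perm_mem psE) inE qr orbT.
apply: minimax_attained ps_pos ps_opt _ _ _ _ => // t /andP[t0 t1].
set q := p / (1 + t).
have t10 : 0 < 1 + t by lra.
have q0 : 0 < q by rewrite divr_gt0.
have pE : p = q + t * q by rewrite /q; field; rewrite gt_eqF.
have tq0 : 0 < t * q by rewrite mulr_gt0.
have qp : q < p by lra.
exists (q :: r); split.
- by rewrite (perm_size psE).
- by move=> x; rewrite inE => /predU1P[->|/rpos].
- move=> z /andP[az _]; have z0 : 0 < z := lt_le_trans p0 az.
  rewrite (perm_blaschke z psE) !blaschke_cons.
  have := @blaschke_factor_lipschitz R z p _ t z0 p0 q0.
  have /andP[r0 r1] := blaschke_itv01 z0 rpos.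
  move=> h; have {}h : `|z - q| / (z + q) <= `|z - p| / (z + p) + 2 * t.
    by apply: h; rewrite ger0_norm; lra.
  apply: (le_trans (ler_wpM2r r0 h)); rewrite mulrDl lerD2l.
  by apply: (@le_trans _ _ (2 * t)); [rewrite ler_piMr //|]; lra.
- move=> z /andP[az z1]; have z0 : 0 < z := lt_le_trans alpha_gt0 az.
  rewrite z1 andbT -ltNge => zp; rewrite (perm_blaschke z psE) !blaschke_cons.
  have /andP[r0 r1] := blaschke_itv01 z0 rpos.
  have [zq|qz] := leP z q.
    by apply: lt_or_eq0_mulr => //; [exact: ltW|exact: blaschke_factor_lt_left].
  left; apply: (@le_trans _ _ (t * 1)); last by rewrite mulr1.
  apply: ler_pM => //; first by rewrite divr_ge0 // addr_ge0 ?(ltW z0) ?(ltW q0).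
  by apply: blaschke_factor_near => //; rewrite ger0_norm; lra.
Qed.

(** Dividing [p] and multiplying [p'] by the same [1 + t] keeps [p * p'] fixed, as
    [blaschke_pair_lt] demands. *)
Lemma minimax_gap_mid (R : realType) (alpha eps : R) (ps r : seq R)
  (p p' : R) :
  0 < alpha -> 0 < eps <= 1 -> {in ps, forall p, 0 < p} ->
  minimax alpha ps eps -> perm_eq ps (p :: p' :: r) ->
  alpha <= p -> p <= p' -> p' <= 1 ->
  exists2 z, p <= z <= p' & blaschke ps z = eps.
Proof.
move=> alpha_gt0 eps_itv ps_pos ps_opt psE ap pp' p1.
have p0 : 0 < p := lt_le_trans alpha_gt0 ap.
have p'0 : 0 < p' := lt_le_trans p0 pp'.
have rpos : {in r, forall q, 0 < q}.
  by move=> q qr; apply: ps_pos; rewrite (perm_mem psE) !inE qr !orbT.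
apply: minimax_attained ps_pos ps_opt _ _ _ _ => // t /andP[t0 t1].
set q := p / (1 + t); set q' := p' * (1 + t).
have t10 : 0 < 1 + t by lra.
have q0 : 0 < q by rewrite divr_gt0.
have q'0 : 0 < q' by rewrite mulr_gt0.
have pE : p = q + t * q by rewrite /q; field; rewrite gt_eqF.
have tq0 : 0 < t * q by rewrite mulr_gt0.
have qp : q < p by lra.
have pq' : p' < q' by rewrite /q' ltr_pMr //; lra.
have tq' : t * p' <= t * q' by rewrite ler_pM2l // ltW.
have q'E : q' = p' + t * p' by rewrite /q'; ring.
have qq : q * q' = p * p' by rewrite /q /q'; field; rewrite gt_eqF.
exists (q :: q' :: r); split.
- by rewrite (perm_size psE).
- by move=> x; rewrite !inE => /or3P[/eqP->|/eqP->|/rpos].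
- move=> z /andP[az _]; have z0 : 0 < z := lt_le_trans p0 az.
  rewrite (perm_blaschke z psE) !blaschke_cons.
  have /andP[r0 r1] := blaschke_itv01 z0 rpos.
  have h1 : `|z - q| / (z + q) <= `|z - p| / (z + p) + 2 * t.
    by apply: blaschke_factor_lipschitz => //; rewrite ger0_norm; lra.
  have h2 : `|z - q'| / (z + q') <= `|z - p'| / (z + p') + 2 * t.
    by apply: blaschke_factor_lipschitz => //; rewrite ler0_norm; lra.
  have /andP[x0 x1] := blaschke_factor_le1 z0 p0.
  have /andP[y0 y1] := blaschke_factor_le1 z0 p'0.
  have /andP[u0 _] := blaschke_factor_le1 z0 q0.
  have /andP[v0 _] := blaschke_factor_le1 z0 q'0.
  move: (`|z - p| / _) (`|z - p'| / _) (`|z - q| / _) (`|z - q'| / _) (blaschke r z)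
    x0 x1 y0 y1 u0 v0 h1 h2 r0 r1 => x y u v w x0 x1 y0 y1 u0 v0 h1 h2 r0 r1.
  rewrite !mulrA; apply: (@le_trans _ _ ((x + 2 * t) * (y + 2 * t) * w)).
    by rewrite ler_wpM2r // ler_pM.
  (* As [x], [y] and [t] are at most 1, the increment is at most [8 * t]: the constant of
     [minimax_attained]. *)
  have -> : (x + 2 * t) * (y + 2 * t) * w = x * y * w + t * (2 * (x + y) + 4 * t) * w.
    by ring.
  rewrite lerD2l; apply: (@le_trans _ _ (t * (2 * (x + y) + 4 * t))).
    by rewrite ler_piMr // mulr_ge0 ?(ltW t0) //; lra.
  by rewrite [leRHS]mulrC ler_pM2l //; lra.
- move=> z /andP[az z1]; have z0 : 0 < z := lt_le_trans alpha_gt0 az.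
  move=> zout; rewrite (perm_blaschke z psE) !blaschke_cons.
  have /andP[r0 r1] := blaschke_itv01 z0 rpos.
  have /andP[u0 u1] := blaschke_factor_le1 z0 q0.
  have /andP[v0 v1] := blaschke_factor_le1 z0 q'0.
  rewrite (mulrA (`|z - q| / (z + q))) (mulrA (`|z - p| / (z + p))).
  have [far|] := boolP ((z <= q) || (q' <= z)).
    by apply: lt_or_eq0_mulr => //; [exact: ltW|exact: blaschke_pair_lt].
  rewrite negb_or -!ltNge => /andP[qz zq']; left.
  move: zout; rewrite negb_and -!ltNge => /orP[zp|p'z].
    have : `|z - q| / (z + q) <= t.
      by apply: blaschke_factor_near => //; rewrite ger0_norm; lra.
    move=> h; apply: (@le_trans _ _ (t * 1 * 1)); last by rewrite !mulr1.
    by apply: ler_pM => //; [exact: mulr_ge0|exact: ler_pM].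
  have : `|z - q'| / (z + q') <= t.
    by apply: blaschke_factor_near => //; apply: le_trans tq'; rewrite ler0_norm; lra.
  move=> h; apply: (@le_trans _ _ (1 * t * 1)); last by rewrite mul1r mulr1.
  by apply: ler_pM => //; [exact: mulr_ge0|exact: ler_pM].
Qed.

Lemma minimax_bound (R : realType) (alpha eps : R) (ps : seq R) :
  (0 < size ps)%N -> 0 < alpha < 1 ->
  {in ps, forall p, alpha <= p <= 1} -> minimax alpha ps eps ->
  eps ^+ 2 <= 4 * expR (- ((size ps)%:R * pi ^+ 2 / ln (4 / alpha))).
Proof.
move=> s0 a01 psa opt; have /andP[a0 a1] := a01.
wlog : ps s0 psa opt / sorted <=%R ps.
  move=> H; have psE : perm_eq (sort <=%R ps) ps by rewrite perm_sort.
  have sE : size (sort <=%R ps) = size ps by rewrite size_sort.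
  rewrite -sE; apply: H; first by rewrite sE.
  - by move=> p; rewrite (perm_mem psE); exact: psa.
  - case: opt => h1 h2; split; last by rewrite sE.
    by move=> z /h1; rewrite (perm_blaschke z psE).
  - exact: sort_le_sorted.
move=> srt.
have pos : {in ps, forall p, 0 < p} by move=> p /psa /andP[h _]; exact: lt_le_trans h.
have e0 : 0 <= eps.
  case: opt => /(_ alpha _) h _; apply: le_trans (h _); last by rewrite lexx ltW.
  exact: blaschke_ge0.
have [e00|en0] := eqVneq eps 0.
  by rewrite e00 expr0n /= mulr_ge0 // expR_ge0.
have {en0}e0 : 0 < eps by rewrite lt_neqAle eq_sym en0.
(* [ps] is its own competitor, and its product is below 1 at every positive point. *)
have e1 : eps < 1.
  case: opt => _ /(_ ps erefl pos)[z /andP[az _] /le_lt_trans]; apply.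
  have z0 := lt_le_trans a0 az.
  have := blaschke_frac_lt1 s0 z0 pos; rewrite normrM normfV.
  by rewrite (gtr0_norm (blaschke_den_gt0 z0 pos)) -blaschkeE.
have e01 : 0 < eps <= 1 by rewrite e0 ltW.
have nth_in i : (i < size ps)%N -> alpha <= nth 0 ps i <= 1.
  by move=> /(mem_nth 0); exact: psa.
have nth_le i j : (i <= j)%N -> (j < size ps)%N -> nth 0 ps i <= nth 0 ps j.
  move=> ij jn; apply: (sorted_leq_nth le_trans lexx) => //.
  by rewrite inE (leq_ltn_trans ij).
have split1 i : (i < size ps)%N ->
    perm_eq ps (nth 0 ps i :: take i ps ++ drop i.+1 ps).
  move=> ilt; rewrite -{1}(cat_take_drop i ps) (drop_nth 0 ilt).
  by rewrite -cat1s perm_catCA perm_refl.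
(* The bound on [j] stands under the existential so that [choice] yields a function on all of [nat];
   beyond [size ps] its value is an arbitrary 0. *)
have zex (j : nat) : exists z, (j <= size ps)%N -> [/\ alpha <= z <= 1,
    blaschke ps z = eps,
    forall i, (i < j)%N -> nth 0 ps i <= z &
    forall i, (j <= i < size ps)%N -> z <= nth 0 ps i].
  have [jn|jn] := leqP j (size ps); last by exists 0.
  have [j0|j0] := posnP j.
    have p01 := nth_in 0%N s0; have /andP[pa p1] := p01.
    have [z /andP[az zp] zE] :=
      minimax_gap_left a0 e01 pos opt (split1 0%N s0) p01.
    exists z => _; split => //; first by rewrite az (le_trans zp).
      by move=> i; rewrite j0.
    by move=> i /andP[_ ilt]; apply: (le_trans zp); exact: nth_le.
  have [jE|jlt] := eqVneq j (size ps).
    have lt : (j.-1 < size ps)%N by rewrite prednK.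
    have p01 := nth_in _ lt; have /andP[pa p1] := p01.
    have [z /andP[pz z1] zE] := minimax_gap_right a0 e01 pos opt (split1 _ lt) p01.
    exists z => _; split => //; first by rewrite z1 (le_trans pa).
      move=> i ij; apply: le_trans pz; apply: nth_le => //.
      by rewrite -ltnS prednK.
    by move=> i /andP[ji]; rewrite -jE ltnNge ji.
  have {}jlt : (j < size ps)%N by rewrite ltn_neqAle jlt.
  have lt : (j.-1 < size ps)%N by rewrite prednK // ltnW.
  have psE : perm_eq ps (nth 0 ps j.-1 :: nth 0 ps j ::
      (take j.-1 ps ++ drop j.+1 ps)).
    rewrite -{1}(cat_take_drop j.-1 ps) (drop_nth 0 lt) prednK // (drop_nth 0 jlt).
    rewrite -[_ :: _ :: drop _ _](cat_cons _ [:: nth 0 ps j]) perm_catCA.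
    exact: perm_refl.
  have /andP[pa _] := nth_in _ lt; have /andP[_ p1] := nth_in _ jlt.
  have pp := nth_le _ _ (leq_pred j) jlt.
  have [z /andP[pz zp] zE] := minimax_gap_mid a0 e01 pos opt psE pa pp p1.
  exists z => _; split => //.
  - by rewrite (le_trans pa pz) (le_trans zp p1).
  - move=> i ij; apply: le_trans pz; apply: nth_le => //.
    by rewrite -ltnS prednK.
  - by move=> i /andP[ji ilt]; apply: (le_trans zp); exact: nth_le.
have [z zP] := choice zex.
by apply: (@equioscillation_bound _ _ z) => //; rewrite e0.
Qed.
(** * Zolotarev's ratio *)

Lemma normc_real (R : realType) (x : R) : Normc.normc x%:C = `|x|.
Proof. by rewrite /Normc.normc /= expr0n /= addr0 sqrtr_sqr. Qed.

Lemma horner_zolotarev_num (R : realType) (q : seq R) (x : R) :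
  (zolotarev_num [seq - p | p <- q]).[x%:C] = (\prod_(p <- q) (x - p))%:C.
Proof.
rewrite horner_prod big_map rmorph_prod; apply: eq_bigr => p _.
by rewrite !hornerE -rmorphD.
Qed.

Lemma horner_zolotarev_den (R : realType) (q : seq R) (x : R) :
  (zolotarev_den [seq - p | p <- q]).[x%:C] = (\prod_(p <- q) (- x - p))%:C.
Proof.
rewrite horner_prod big_map rmorph_prod; apply: eq_bigr => p _.
by rewrite !hornerE -rmorphN -rmorphD.
Qed.

Lemma rat_abs_zolotarev_pos (R : realType) (q : seq R) (x : R) : 0 < x ->
  {in q, forall p, 0 < p} ->
  rat_abs (zolotarev_num [seq - p | p <- q]) (zolotarev_den [seq - p | p <- q]) x%:C
    = (blaschke q x)%:E.
Proof.
move=> x0 pos; rewrite /rat_abs horner_zolotarev_num horner_zolotarev_den.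
have d0 : \prod_(p <- q) (- x - p) != 0.
  rewrite prodf_seq_neq0; apply/allP => p /pos p0 /=.
  by rewrite lt_eqF //; lra.
rewrite fmorph_eq0 (negbTE d0) -fmorph_div normc_real normrM normfV !normr_prod.
rewrite /blaschke prodf_div; congr (_ / _)%:E.
by apply: eq_big_seq => p /pos p0; rewrite ler0_norm; lra.
Qed.

(** This is [r(- x) = 1 / r(x)], in extended reals so that it includes the poles, where the product
    vanishes. *)
Lemma rat_abs_zolotarev_neg (R : realType) (q : seq R) (x : R) : 0 < x ->
  {in q, forall p, 0 < p} ->
  rat_abs (zolotarev_num [seq - p | p <- q]) (zolotarev_den [seq - p | p <- q])
    (- x)%:C = ((blaschke q x)%:E^-1)%E.
Proof.
move=> x0 pos; rewrite /rat_abs horner_zolotarev_num horner_zolotarev_den opprK.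
rewrite fmorph_eq0 inver.
have bE : blaschke q x = `|\prod_(p <- q) (x - p)| / \prod_(p <- q) (x + p).
  by rewrite blaschkeE horner_blaschke_num horner_blaschke_den.
have h0 : 0 < \prod_(p <- q) (x + p).
  by have := blaschke_den_gt0 x0 pos; rewrite horner_blaschke_den.
have -> : (\prod_(p <- q) (x - p) == 0) = (blaschke q x == 0).
  by rewrite bE mulf_eq0 invr_eq0 (gt_eqF h0) orbF normr_eq0.
case: ifPn => // _; rewrite -fmorph_div normc_real normrM normfV bE invf_div.
congr (_ / _)%:E; rewrite normr_prod; apply: eq_big_seq => p /pos p0.
by rewrite ler0_norm; lra.
Qed.

(** By [r(- x) = 1 / r(x)] the infimum over [[-1, - alpha]] is the inverse of the supremum over
    [[alpha, 1]], so the ratio is the square of the latter. This lemma and the next are the two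
    inequalities. *)
Lemma zolotarev_ratio_le (R : realType) (q : seq R) (alpha M : R) :
  0 < alpha <= 1 -> 0 < M ->
  {in q, forall p, 0 < p} -> (forall x, alpha <= x <= 1 -> blaschke q x <= M) ->
  (zolotarev_ratio alpha 1 (zolotarev_num [seq (- p)%R | p <- q])
    (zolotarev_den [seq (- p)%R | p <- q]) <= (M ^+ 2)%:E)%E.
Proof.
move=> /andP[a0 a1] M0 pos qM; rewrite /zolotarev_ratio.
set num := ereal_sup _; set den := ereal_inf _.
have numM : (num <= M%:E)%E.
  apply: ge_ereal_sup => _ [x /= xa <-]; move: xa; rewrite in_itv /= => xa.
  have x0 : 0 < x by case/andP: xa => /(lt_le_trans a0).
  by rewrite rat_abs_zolotarev_pos // lee_fin qM.
have num0 : (0 <= num)%E.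
  apply: (@le_trans _ _ (blaschke q alpha)%:E).
    by rewrite lee_fin blaschke_ge0.
  apply: ereal_sup_ubound; exists alpha; first by rewrite /= in_itv /= lexx.
  by rewrite rat_abs_zolotarev_pos.
have denM : ((M^-1)%:E <= den)%E.
  apply: le_ereal_inf_tmp => _ [x /= xa <-]; move: xa; rewrite in_itv /= => xa.
  have {}xa : alpha <= - x <= 1 by case/andP: xa => h1 h2; apply/andP; split; lra.
  have x0 : 0 < - x by case/andP: xa => /(lt_le_trans a0).
  rewrite -[x]opprK rat_abs_zolotarev_neg //.
  have -> : (M^-1)%:E = (M%:E^-1)%E by rewrite inver gt_eqF.
  by rewrite lee_pV2 ?inE /= ?lee_fin ?qM ?blaschke_ge0 // ltW.
have M1 : (0 < (M^-1)%:E)%E by rewrite lte_fin invr_gt0.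
have den0 : (0 <= den)%E by apply: le_trans denM; exact: ltW.
have -> : (M ^+ 2)%:E = (M%:E * M%:E)%E by rewrite -EFinM.
apply: lee_pmul => //; first by rewrite inve_ge0.
have -> : M%:E = ((M^-1)%:E^-1)%E by rewrite inver invr_eq0 gt_eqF // invrK.
by rewrite lee_pV2 ?inE // ltW.
Qed.

Lemma zolotarev_ratio_ge (R : realType) (q : seq R) (alpha x : R) :
  0 < alpha -> alpha <= x <= 1 -> {in q, forall p, 0 < p} -> 
  ((blaschke q x ^+ 2)%:E <=
   zolotarev_ratio alpha 1 (zolotarev_num [seq (- p)%R | p <- q])
    (zolotarev_den [seq (- p)%R | p <- q]))%E.
Proof.
move=> a0 xa pos; rewrite /zolotarev_ratio.
set num := ereal_sup _; set den := ereal_inf _.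
have x0 : 0 < x by case/andP: xa => /(lt_le_trans a0).
have b0 : 0 <= blaschke q x by exact: blaschke_ge0.
have numM : ((blaschke q x)%:E <= num)%E.
  apply: ereal_sup_ubound; exists x; first by rewrite /= in_itv.
  by rewrite rat_abs_zolotarev_pos.
have denM : (den <= (blaschke q x)%:E^-1)%E.
  apply: ereal_inf_lbound; exists (- x); first by rewrite /= in_itv /= !lerN2 andbC.
  by rewrite rat_abs_zolotarev_neg.
have den0 : (0 <= den)%E.
  apply: le_ereal_inf_tmp => _ [y /= _ <-]; rewrite /rat_abs.
  case: ifP => // _; rewrite lee_fin; case: (_ / _) => u w; exact: sqrtr_ge0.
have -> : (blaschke q x ^+ 2)%:E = ((blaschke q x)%:E * (blaschke q x)%:E)%E.
  by rewrite -EFinM.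
apply: lee_pmul => //; rewrite -[leLHS]inveK lee_pV2 ?inE ?inve_ge0 //.
Qed.

Lemma zolotarev_ratfun (R : realType) (q : seq R) : {in q, forall p, 0 < p} ->
  ratfun (size q) (zolotarev_num [seq - p | p <- q])
    (zolotarev_den [seq - p | p <- q]).
Proof.
move=> pos.
have numE : zolotarev_num [seq - p | p <- q] = \prod_(p <- q) ('X - (p%:C)%:P).
  rewrite /zolotarev_num big_map; apply: eq_bigr => p _.
  by rewrite rmorphN polyCN.
have denE : zolotarev_den [seq - p | p <- q]
    = (-1) ^+ size q * \prod_(p <- q) ('X - ((- p)%:C)%:P).
  rewrite /zolotarev_den big_map -prod_oppr; apply: eq_bigr => p _.
  by rewrite opprB addrC.
have sden : size (zolotarev_den [seq - p | p <- q]) = (size q).+1.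
  rewrite denE -signr_odd mulr_sign; case: odd; rewrite ?size_polyN;
  exact: size_prod_XsubC.
have snum : size (zolotarev_num [seq - p | p <- q]) = (size q).+1.
  by rewrite numE size_prod_XsubC.
split; rewrite ?snum ?sden // -?size_poly_eq0 ?snum ?sden //.
apply/Pdiv.ClosedField.coprimepP => z; rewrite numE /root horner_prod.
rewrite prodf_seq_eq0 => /hasP[p pq /=]; rewrite !hornerE subr_eq0 => /eqP ->.
rewrite horner_zolotarev_den fmorph_eq0 prodf_seq_neq0; apply/allP => r rq /=.
by rewrite lt_eqF //; have := pos p pq; have := pos r rq; lra.
Qed.

Lemma zolotarev_minimax (R : realType) (l : nat) (alpha : R) (psi : l.-tuple R) :
  0 < alpha < 1 -> (0 < l)%N -> zolotarev_poles alpha 1 psi ->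
  exists eps, minimax alpha [seq - p | p <- psi] eps.
Proof.
move=> /andP[a0 a1] l0 [psia opt]; set q := [seq - p | p <- psi].
have psiE : [seq - p | p <- q] = psi.
  by rewrite /q -map_comp -[RHS]map_id; apply: eq_map => p /=; rewrite opprK.
have pos : {in q, forall p, 0 < p}.
  by move=> _ /mapP[p /psia /andP[_ h] ->]; lra.
have sq : size q = l by rewrite size_map size_tuple.
have [w wa wmax] := blaschke_max a0 (ltW a1) pos.
exists (blaschke q w); split=> // r sr rpos.
have w0 : 0 < w by case/andP: wa => /(lt_le_trans a0).
have b0 : 0 <= blaschke q w by exact: blaschke_ge0.
have [v va vmax] := blaschke_max a0 (ltW a1) rpos.
have v0 : 0 < v by case/andP: va => /(lt_le_trans a0).
have br0 : 0 <= blaschke r v by exact: blaschke_ge0.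
exists v => //; rewrite leNgt; apply/negP => vw.
(* The midpoint lies strictly below the maximum for [q], and [vw] makes it positive, as
   [zolotarev_ratio_le] demands. *)
pose M := (blaschke r v + blaschke q w) / 2.
have M0 : 0 < M by rewrite divr_gt0 //; lra.
have a01 : 0 < alpha <= 1 by rewrite a0 ltW.
have up : forall x, alpha <= x <= 1 -> blaschke r x <= M.
  by move=> x xa; apply: (le_trans (vmax x xa)); rewrite ler_pdivlMr //; lra.
have := zolotarev_ratio_ge a0 wa pos; rewrite psiE => ge.
have rf := zolotarev_ratfun rpos; rewrite sr sq in rf.
have := le_trans ge (le_trans (opt _ _ rf) (zolotarev_ratio_le a01 M0 rpos up)).
rewrite lee_fin leNgt => /negP; apply.
rewrite ltr_pXn2r ?nnegrE ?(ltW M0) // /M ltr_pdivrMr //; lra.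
Qed.

Lemma zolotarev_bound (R : realType) (l : nat) (alpha : R) (psi : l.-tuple R) :
  0 < alpha < 1 -> (0 < l)%N -> zolotarev_poles alpha 1 psi ->
  exists eps : R, [/\ 0 <= eps,
    forall z, alpha <= z <= 1 -> blaschke [seq - p | p <- psi] z <= eps &
    eps ^+ 2 <= 4 * rho alpha 1 ^+ l].
Proof.
move=> a01 l0 opt; have [eps mm] := zolotarev_minimax a01 l0 opt.
have psia : {in [seq - p | p <- psi], forall p, alpha <= p <= 1}.
  move=> _ /mapP[p /(opt.1) /andP[h1 h2] ->]; apply/andP; split; lra.
have /andP[a0 a1] := a01.
exists eps; split.
- apply: le_trans (mm.1 alpha _); last by rewrite lexx ltW.
  apply: blaschke_ge0 => // p /psia /andP[h _]; exact: lt_le_trans h.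
- exact: mm.1.
rewrite /rho -expRM_natl mulr1 mulrN mulrA.
have := @minimax_bound R alpha eps [seq - p | p <- psi]; rewrite size_map size_tuple.
by apply.
Qed.
(** * Norms and functions of Hermitian matrices *)

Lemma normC_normc (R : realType) (z : R[i]) : `|z| = (Normc.normc z)%:C.
Proof. by []. Qed.

Lemma trmxC_mul (R : realType) (m n p : nat) (A : 'M[R[i]]_(m, n))
  (B : 'M[R[i]]_(n, p)) : (A *m B)^t* = B^t* *m A^t*.
Proof. by rewrite trmx_mul map_mxM. Qed.

Lemma hermsymmx_trmxC (R : realType) (n : nat) (A : 'M[R[i]]_n) :
  (A \is hermsymmx) = (A^t* == A).
Proof.
apply/is_hermitianmxP/eqP; rewrite expr0 scale1r => H; last by rewrite H.
by rewrite [in RHS]H.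
Qed.

Lemma eucl_norm_ge0 (R : realType) (n : nat) (x : 'cV[R[i]]_n) : 0 <= eucl_norm x.
Proof. exact: sqrtr_ge0. Qed.

Lemma eucl_norm_sqr (R : realType) (n : nat) (x : 'cV[R[i]]_n) :
  (eucl_norm x ^+ 2)%:C = (x^t* *m x) 0 0.
Proof.
rewrite /eucl_norm sqr_sqrtr; last by apply: sumr_ge0 => i _; exact: sqr_ge0.
rewrite rmorph_sum mxE; apply: eq_bigr => i _.
by rewrite rmorphXn /= -normC_normc normCK !mxE mulrC.
Qed.

Lemma eucl_norm_isometry (R : realType) (m n : nat) (Q : 'M[R[i]]_(m, n))
  (x : 'cV[R[i]]_n) : Q^t* *m Q = 1%:M -> eucl_norm (Q *m x) = eucl_norm x.
Proof.
move=> QQ; apply/eqP; rewrite -(@eqrXn2 _ 2) ?eucl_norm_ge0 //; apply/eqP/complexI.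
by rewrite !eucl_norm_sqr trmxC_mul mulmxA -(mulmxA (x^t*)) QQ mulmx1.
Qed.

Lemma eucl_norm0 (R : realType) (n : nat) : eucl_norm (0 : 'cV[R[i]]_n) = 0.
Proof.
rewrite /eucl_norm big1 ?sqrtr0 // => i _.
by rewrite mxE Normc.normc0 expr0n.
Qed.

Lemma norm_inner_le (R : realType) (n : nat) (y x : 'cV[R[i]]_n) :
  Normc.normc ((y^t* *m x) 0 0) <= eucl_norm y * eucl_norm x.
Proof.
have : `|dotmx (y^t*) (x^t*)| ^+ 2 <= dotmx (y^t*) (y^t*) * dotmx (x^t*) (x^t*).
  by have [] := CauchySchwarz (@dotmx R[i] n) (y^t*) (x^t*).
rewrite !dotmxE !trmxCK -!eucl_norm_sqr normC_normc -rmorphXn /= -rmorphM lecR -exprMn.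
rewrite ler_pXn2r ?nnegrE ?mulr_ge0 ?eucl_norm_ge0 //.
by case: (_ 0 0) => u v; exact: sqrtr_ge0.
Qed.

Lemma Re_le_normc (R : realType) (z : R[i]) : complex.Re z <= Normc.normc z.
Proof.
have := normc_ge_Re z; rewrite normC_normc lecR; apply: le_trans.
exact: ler_norm.
Qed.

(** With [y = U^t* *m x], the square of the norm of [y] is the inner product of [U *m y] and [x];
    Cauchy-Schwarz and the isometry [U] conclude. *)
Lemma eucl_norm_adjoint_le (R : realType) (m n : nat) (U : 'M[R[i]]_(m, n))
  (x : 'cV[R[i]]_m) : U^t* *m U = 1%:M -> eucl_norm (U^t* *m x) <= eucl_norm x.
Proof.
move=> UU; set y := U^t* *m x.
have [->|y0] := eqVneq (eucl_norm y) 0; first exact: eucl_norm_ge0.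
have {}y0 : 0 < eucl_norm y by rewrite lt_neqAle eq_sym y0 eucl_norm_ge0.
rewrite -(ler_pM2l y0) -expr2 -{2}(eucl_norm_isometry y UU).
have : complex.Re ((y^t* *m y) 0 0) <= eucl_norm (U *m y) * eucl_norm x.
  have -> : y^t* *m y = (U *m y)^t* *m x by rewrite trmxC_mul /y mulmxA.
  by apply: le_trans (Re_le_normc _) (norm_inner_le _ _).
by rewrite -eucl_norm_sqr.
Qed.

Lemma eucl_norm_coef_le (R : realType) (n : nat) (x : 'cV[R[i]]_n) (i : 'I_n) :
  Normc.normc (x i 0) <= eucl_norm x.
Proof.
have n0 (z : R[i]) : 0 <= Normc.normc z by case: z => u v; exact: sqrtr_ge0.
rewrite -(@ler_pXn2r _ 2) ?nnegrE ?eucl_norm_ge0 //.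
rewrite /eucl_norm sqr_sqrtr; last by apply: sumr_ge0 => j _; exact: sqr_ge0.
by rewrite (bigD1 i) //= lerDl; apply: sumr_ge0 => j _; exact: sqr_ge0.
Qed.

Lemma eucl_norm_le (R : realType) (n : nat) (x : 'cV[R[i]]_n) (c : 'I_n -> R) :
  (forall i, Normc.normc (x i 0) <= c i) ->
  eucl_norm x <= Num.sqrt (\sum_i c i ^+ 2).
Proof.
have n0 (z : R[i]) : 0 <= Normc.normc z by case: z => u v; exact: sqrtr_ge0.
move=> xc; rewrite ler_wsqrtr //; apply: ler_sum => i _.
by rewrite lerXn2r ?nnegrE // (le_trans _ (xc i)).
Qed.

Lemma eucl_norm_mul_le_spec_norm (R : realType) (m n : nat)
  (M : 'M[R[i]]_(m, n)) (x : 'cV[R[i]]_n) : eucl_norm x <= 1 ->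
  eucl_norm (M *m x) <= spec_norm M.
Proof.
move=> x1; apply: ub_le_sup; last by exists x.
(* Any finite bound will do; without one, [sup] would be a default value. *)
exists (Num.sqrt (\sum_i (\sum_j Normc.normc (M i j)) ^+ 2)) => _ [y /= y1 <-].
apply: eucl_norm_le => i; rewrite mxE.
have n0 (z : R[i]) : 0 <= Normc.normc z by case: z => u v; exact: sqrtr_ge0.
have sum_le (F : 'I_n -> R[i]) :
    Normc.normc (\sum_j F j) <= \sum_j Normc.normc (F j).
  elim/big_ind2: _ => [|a b c d h1 h2|//]; first by rewrite Normc.normc0.
  exact: le_trans (le_normcD _ _) (lerD h1 h2).
apply: (le_trans (sum_le _)); apply: ler_sum => j _.
by rewrite Normc.normcM ler_piMr // (le_trans (eucl_norm_coef_le _ _)).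
Qed.

Lemma spec_norm_le (R : realType) (m n : nat) (M : 'M[R[i]]_(m, n)) (B : R) :
  (forall x, eucl_norm x <= 1 -> eucl_norm (M *m x) <= B) -> spec_norm M <= B.
Proof.
move=> H; apply: ge_sup; first by exists (eucl_norm (M *m 0)), 0 => //=; rewrite eucl_norm0.
by move=> _ [x /= x1 <-]; exact: H.
Qed.

Lemma mxfun_ext (R : realType) (n : nat) (f g : R[i] -> R[i]) (A : 'M[R[i]]_n) :
  (forall i, f (spectral_diag A 0 i) = g (spectral_diag A 0 i)) ->
  mxfun f A = mxfun g A.
Proof.
move=> fg; rewrite /mxfun (_ : map_mx f _ = map_mx g (spectral_diag A)) //.
by apply/rowP => i; rewrite !mxE fg.
Qed.

Lemma mxfunD (R : realType) (n : nat) (f g : R[i] -> R[i]) (A : 'M[R[i]]_n) :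
  mxfun (fun z => f z + g z) A = mxfun f A + mxfun g A.
Proof.
rewrite /mxfun -mulmxDl -mulmxDr -raddfD /=; congr (_ *m diag_mx _ *m _).
by apply/rowP => i; rewrite !mxE.
Qed.

Lemma mxfunM (R : realType) (n : nat) (f g : R[i] -> R[i]) (A : 'M[R[i]]_n) :
  mxfun (fun z => f z * g z) A = mxfun f A *m mxfun g A.
Proof.
rewrite /mxfun !mulmxA mulmxK ?spectral_unit // -(mulmxA _ (diag_mx _) (diag_mx _)) mulmx_diag.
rewrite (_ : map_mx (fun z => f z * g z) _ =
  \row_i (map_mx f (spectral_diag A) 0 i * map_mx g (spectral_diag A) 0 i)) //.
by apply/rowP => i; rewrite !mxE.
Qed.

Lemma mxfun_cst (R : realType) (n : nat) (c : R[i]) (A : 'M[R[i]]_n) :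
  mxfun (fun=> c) A = c%:M.
Proof.
rewrite /mxfun (_ : diag_mx _ = c%:M); last first.
  by rewrite -diag_const_mx; congr diag_mx; apply/rowP => i; rewrite !mxE.
by rewrite scalar_mxC mulmxKV ?spectral_unit.
Qed.

Lemma mxfunZ (R : realType) (n : nat) (c : R[i]) (f : R[i] -> R[i])
  (A : 'M[R[i]]_n) : mxfun (fun z => c * f z) A = c *: mxfun f A.
Proof. by rewrite mxfunM mxfun_cst mul_scalar_mx. Qed.

Lemma mxfun_id (R : realType) (n : nat) (A : 'M[R[i]]_n) : A \is normalmx ->
  mxfun id A = A.
Proof.
move=> /orthomx_spectralP AE; rewrite [RHS]AE /mxfun.
rewrite (_ : map_mx id _ = spectral_diag A) //.
by apply/rowP => i; rewrite !mxE.
Qed.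

Lemma mxfunX (R : realType) (n : nat) (j : nat) (A : 'M[R[i]]_n) :
  A \is normalmx -> mxfun (fun z => z ^+ j) A = A ^+ j.
Proof.
move=> An; elim: j => [|j IH]; first by rewrite mxfun_cst.
rewrite (_ : (fun z => z ^+ j.+1) = (fun z => z * z ^+ j)); last first.
  by apply/funext => z; rewrite exprS.
by rewrite mxfunM IH mxfun_id // exprS.
Qed.

Lemma mxfun_sum (R : realType) (n : nat) (I : Type) (s : seq I)
  (F : I -> R[i] -> R[i]) (A : 'M[R[i]]_n) :
  mxfun (fun z => \sum_(i <- s) F i z) A = \sum_(i <- s) mxfun (F i) A.
Proof.
elim: s => [|i s IH].
  rewrite big_nil (_ : (fun z => _) = fun=> 0); last first.
    by apply/funext => z; rewrite big_nil.
  by rewrite mxfun_cst; apply/matrixP => i j; rewrite !mxE mul0rn.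
rewrite big_cons -IH -mxfunD; congr mxfun.
by apply/funext => z; rewrite big_cons.
Qed.

Lemma mxfun_prod (R : realType) (n : nat) (I : Type) (s : seq I)
  (F : I -> R[i] -> R[i]) (A : 'M[R[i]]_n) :
  mxfun (fun z => \prod_(i <- s) F i z) A = \prod_(i <- s) mxfun (F i) A.
Proof.
elim: s => [|i s IH].
  rewrite big_nil (_ : (fun z => _) = fun=> 1); last first.
    by apply/funext => z; rewrite big_nil.
  by rewrite mxfun_cst.
rewrite big_cons -IH -[_ * _]/(_ *m _) -mxfunM; congr mxfun.
by apply/funext => z; rewrite big_cons.
Qed.

Lemma mxfun_horner (R : realType) (n : nat) (p : {poly R[i]}) (A : 'M[R[i]]_n) :
  A \is normalmx ->
  mxfun (fun z => p.[z]) A = \sum_(j < size p) p`_j *: A ^+ j.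
Proof.
move=> An; rewrite (_ : (fun z => p.[z]) = fun z => \sum_(j < size p) p`_j * z ^+ j);
  last by apply/funext => z; rewrite horner_coef.
by rewrite mxfun_sum; apply: eq_bigr => j _; rewrite mxfunZ mxfunX.
Qed.

Lemma mxfun_poles (R : realType) (n : nat) (Psi : seq (option R[i]))
  (A : 'M[R[i]]_n) : A \is normalmx ->
  mxfun (fun z => \prod_(p <- pmap id Psi) (z - p)) A = pole_mx A Psi.
Proof.
move=> An; rewrite mxfun_prod; apply: eq_bigr => p _.
by rewrite mxfunD mxfun_id // mxfun_cst -raddfN.
Qed.

Lemma eucl_norm_mxfun_le (R : realType) (n : nat) (f : R[i] -> R[i])
  (A : 'M[R[i]]_n) (x : 'cV[R[i]]_n) (M : R) : 0 <= M ->
  (forall i, Normc.normc (f (spectral_diag A 0 i)) <= M) ->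
  eucl_norm (mxfun f A *m x) <= M * eucl_norm x.
Proof.
move=> M0 fM; set P := spectralmx A.
have Pu : P \is unitarymx by exact: spectral_unitarymx.
have n0 (z : R[i]) : 0 <= Normc.normc z by case: z => u v; exact: sqrtr_ge0.
have -> : eucl_norm x = eucl_norm (P *m x).
  by rewrite eucl_norm_isometry // -(invmx_unitary Pu) mulVmx // spectral_unit.
rewrite /mxfun -!mulmxA -/P invmx_unitary // eucl_norm_isometry; last first.
  by rewrite trmxCK; exact/unitarymxP.
rewrite -{1}(ger0_norm M0) -sqrtr_sqr -sqrtrM ?sqr_ge0 // ler_wsqrtr //.
rewrite mulr_sumr; apply: ler_sum => i _.
rewrite mul_diag_mx !mxE Normc.normcM exprMn ler_wpM2r ?sqr_ge0 //.
by rewrite lerXn2r ?nnegrE.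
Qed.
Lemma spectral_diag_eigenvalue (R : realType) (n : nat) (A : 'M[R[i]]_n)
  (i : 'I_n) : A \is normalmx -> eigenvalue A (spectral_diag A 0 i).
Proof.
move=> /orthomx_spectralP AE; apply/eigenvalueP.
exists (row i (spectralmx A)).
  rewrite [X in _ *m X]AE !mulmxA rowE mulmxK ?spectral_unit //.
  by rewrite -(rowE i (diag_mx _)) row_diag_mx -scalemxAl.
apply/eqP; rewrite rowE => /(congr1 (mulmx^~ (invmx (spectralmx A)))).
rewrite mulmxK ?spectral_unit // mul0mx => /matrixP /(_ 0 i) /eqP.
by rewrite !mxE !eqxx oner_eq0.
Qed.

Lemma mxfunC (R : realType) (n : nat) (f g : R[i] -> R[i]) (A : 'M[R[i]]_n) :
  mxfun f A *m mxfun g A = mxfun g A *m mxfun f A.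
Proof. by rewrite -[LHS]mxfunM -[RHS]mxfunM; apply: mxfun_ext => i; rewrite mulrC. Qed.

Lemma quad_form_itv (R : realType) (n : nat) (A : 'M[R[i]]_n) (a b : R[i])
  (y : 'rV[R[i]]_n) : A \is normalmx ->
  (forall i, a <= spectral_diag A 0 i <= b) ->
  a * (y *m y^t*) 0 0 <= (y *m A *m y^t*) 0 0 <= b * (y *m y^t*) 0 0.
Proof.
move=> /orthomx_spectralP AE dab.
have Pu := spectral_unitarymx A; set P := spectralmx A in AE Pu.
set d := spectral_diag A in AE dab.
pose u := y *m P^t*.
have PP : P^t* *m P = 1%:M by rewrite -(invmx_unitary Pu) mulVmx // unitarymx_unit.
have -> : y *m y^t* = u *m u^t*.
  by rewrite /u trmxC_mul trmxCK mulmxA -(mulmxA y) PP mulmx1.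
have -> : y *m A *m y^t* = u *m diag_mx d *m u^t*.
  by rewrite /u trmxC_mul trmxCK AE invmx_unitary // !mulmxA.
have uE : (u *m u^t*) 0 0 = \sum_i `|u 0 i| ^+ 2.
  by rewrite mxE; apply: eq_bigr => i _; rewrite !mxE -normCK.
have -> : (u *m diag_mx d *m u^t*) 0 0 = \sum_i d 0 i * `|u 0 i| ^+ 2.
  rewrite mxE; apply: eq_bigr => i _.
  by rewrite mul_mx_diag !mxE mulrAC -normCK mulrC.
rewrite uE !mulr_sumr; apply/andP; split; apply: ler_sum => i _;
  have /andP[h1 h2] := dab i; by rewrite ler_wpM2r ?exprn_ge0.
Qed.

(** For a left eigenvector [x] of the compression, the eigenvalue is the Rayleigh quotient of [A] at
    [x *m U^t*]. *)
Lemma compression_spectral_itv (R : realType) (n k : nat) (A : 'M[R[i]]_n)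
  (U : 'M[R[i]]_(n, k)) (a b : R[i]) : A \is hermsymmx ->
  (forall i, a <= spectral_diag A 0 i <= b) -> U^t* *m U = 1%:M ->
  U^t* *m A *m U \is hermsymmx /\
  forall i, a <= spectral_diag (U^t* *m A *m U) 0 i <= b.
Proof.
move=> Ah dab UU; have An := hermitian_normalmx Ah.
have Bh : U^t* *m A *m U \is hermsymmx.
  move: Ah; rewrite !hermsymmx_trmxC => /eqP Ah.
  by rewrite !trmxC_mul trmxCK Ah mulmxA.
split=> // i; have /eigenvalueP[x xE x0] :=
  spectral_diag_eigenvalue i (hermitian_normalmx Bh).
set th := spectral_diag _ _ _ in xE *.
have xx : 0 < (x *m x^t*) 0 0 by rewrite -dotmxE dotmx_is_dotmx.
have := quad_form_itv (x *m U^t*) An dab.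
have -> : x *m U^t* *m (x *m U^t*)^t* = x *m x^t*.
  by rewrite trmxC_mul trmxCK mulmxA -(mulmxA x) UU mulmx1.
have -> : (x *m U^t* *m A *m (x *m U^t*)^t*) 0 0 = th * (x *m x^t*) 0 0.
  by rewrite trmxC_mul trmxCK mulmxA -(mulmxA x _ A) -(mulmxA x _ U) xE -scalemxAl [LHS]mxE.
by rewrite !ler_pM2r.
Qed.

(** * Rational Krylov approximation of resolvents *)

(* A rational function of degree at most [l] with the poles [Psi] is evaluated
   exactly by the projection onto the rational Krylov space. *)
Lemma rat_krylov_exact (R : realType) (n s k l : nat) (A : 'M[R[i]]_n)
  (v : 'M[R[i]]_(n, s)) (Psi : l.-tuple (option R[i])) (U : 'M[R[i]]_(n, k))
  (p : {poly R[i]}) :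
  let q z := \prod_(x <- pmap id Psi) (z - x) in
  let Al := U^t* *m A *m U in
  A \is normalmx -> Al \is normalmx ->
  (forall i, q (spectral_diag A 0 i) != 0) ->
  (forall i, q (spectral_diag Al 0 i) != 0) ->
  orthonormal_basis U (rat_krylov A v Psi) -> (size p <= l.+1)%N ->
  mxfun (fun z => p.[z] / q z) A *m v =
    U *m mxfun (fun z => p.[z] / q z) Al *m (U^t* *m v).
Proof.
move=> q Al An Aln qA qAl [UU /eqmxP UV] sp.
set W := mxfun (fun z => (q z)^-1) A *m v.
have qqV n' (B : 'M[R[i]]_n') : (forall i, q (spectral_diag B 0 i) != 0) ->
    mxfun q B *m mxfun (fun z => (q z)^-1) B = 1%:M.
  move=> qB; rewrite -mxfunM -(mxfun_cst 1 B); apply: mxfun_ext => i.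
  by rewrite divff.
have invE : invmx (pole_mx A Psi) = mxfun (fun z => (q z)^-1) A.
  rewrite -mxfun_poles // -/q; have qq := qqV _ _ qA.
  have [u _] := mulmx1_unit qq.
  by rewrite -[LHS]mulmx1 -qq mulKmx.
have WE : mxfun q A *m W = v by rewrite mulmxA qqV // mul1mx.
have KE j : invmx (pole_mx A Psi) *m A ^+ j *m v = A ^+ j *m W.
  have VX : mxfun (fun z => (q z)^-1) A *m A ^+ j = A ^+ j *m mxfun (fun z => (q z)^-1) A.
    by rewrite -(mxfunX j An); exact: mxfunC.
  by rewrite invE VX /W mulmxA.
have inU j : (j < l.+1)%N -> U *m (U^t* *m (A ^+ j *m W)) = A ^+ j *m W.
  move=> jl; have : ((A ^+ j *m W)^T <= U^T)%MS.
    rewrite UV -KE; apply: (sumsmx_sup (Ordinal jl)) => //.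
    by rewrite genmxE.
  move=> /submxP[D /(congr1 trmx)]; rewrite trmxK trmx_mul trmxK => ->.
  by rewrite !mulmxA -(mulmxA U) UU mulmx1.
(* As long as [j <= l], the vectors [A ^+ j *m W] are in the range of [U], so the projector
   [U *m U^t*] may be inserted before each further factor [A], which becomes [Al]. *)
have AlE j : (j < l.+1)%N -> A ^+ j *m W = U *m (Al ^+ j *m (U^t* *m W)).
  elim: j => [|j IH] jl; first by have := inU 0%N jl; rewrite !expr0 !mul1mx => ->.
  rewrite -{1}inU // exprS -[A * _]/(A *m _) -(mulmxA A) IH ?(ltnW jl) //.
  by rewrite exprS -[Al * _]/(Al *m _) /Al !mulmxA.
have pE (r : {poly R[i]}) : (size r <= l.+1)%N ->
    mxfun (fun z => r.[z]) A *m W = U *m (mxfun (fun z => r.[z]) Al *m (U^t* *m W)).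
  move=> sr; rewrite !mxfun_horner // !mulmx_suml mulmx_sumr.
  apply: eq_bigr => j _; rewrite -!scalemxAl -scalemxAr AlE //.
  exact: leq_trans sr.
have qpoly : exists2 r : {poly R[i]}, (size r <= l.+1)%N & q = fun z => r.[z].
  exists (\prod_(x <- pmap id Psi) ('X - x%:P)).
    rewrite size_prod_XsubC ltnS size_pmap (leq_trans (count_size _ _)) //.
    by rewrite size_tuple.
  by apply/funext => z; rewrite horner_prod; apply: eq_bigr => x _; rewrite !hornerE.
(* The case of [q] itself, a polynomial of degree at most [l]: it gives
   [v = U *m (mxfun q Al *m (U^t* *m W))], which is solved for [U^t* *m W]. *)
have UvE : U^t* *m W = mxfun (fun z => (q z)^-1) Al *m (U^t* *m v).
  have [r sr rE] := qpoly.
  have := pE r sr; rewrite -rE WE => vE.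
  rewrite [in RHS]vE (mulmxA (U^t*) U) UU mul1mx mulmxA.
  have -> : mxfun (fun z => (q z)^-1) Al *m mxfun q Al = 1%:M.
    by apply: mulmx1C; exact: qqV.
  by rewrite mul1mx.
rewrite [in LHS]mxfunM -mulmxA -[mxfun _ A *m v]/W pE // UvE.
by rewrite [in RHS]mxfunM !mulmxA.
Qed.

(** * Integrals of resolvents and scalar functionals *)

Lemma Rintegral_sum_cauchy (R : realType)
  (mu : {measure set (measurableTypeR R) -> \bar R})
  (D : set (measurableTypeR R)) (s : seq (R * R)) : measurable D ->
  (forall cr, cr \in s -> mu.-integrable D (fun t => ((t + cr.2)^-1)%:E)) ->
  mu.-integrable D (fun t => (\sum_(cr <- s) cr.1 * (t + cr.2)^-1)%:E) /\
  Rintegral mu D (fun t => \sum_(cr <- s) cr.1 * (t + cr.2)^-1)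
    = \sum_(cr <- s) cr.1 * Rintegral mu D (fun t => (t + cr.2)^-1).
Proof.
move=> mD; elim: s => [|cr s IH] H.
  split.
    rewrite (_ : (fun _ => _) = cst 0%E); last first.
      by apply/funext => t; rewrite big_nil.
    exact: integrable0.
  rewrite big_nil (_ : (fun _ => _) = cst 0); last first.
    by apply/funext => t; rewrite big_nil.
  by rewrite /Rintegral integral0.
have [|int IE] := IH; first by move=> x xs; apply: H; rewrite inE xs orbT.
have int1 : mu.-integrable D (EFin \o (fun t => cr.1 * (t + cr.2)^-1)).
  rewrite (_ : _ \o _ = (fun t => (cr.1)%:E * ((t + cr.2)^-1)%:E)%E).
    by apply: integrableZl => //; apply: H; rewrite mem_head.
  by apply/funext => t /=; rewrite EFinM.
have E : (fun t => \sum_(x <- cr :: s) x.1 * (t + x.2)^-1)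
    = (fun t => cr.1 * (t + cr.2)^-1 + \sum_(x <- s) x.1 * (t + x.2)^-1).
  by apply/funext => t; rewrite big_cons.
split.
  rewrite (_ : (fun t => _) = (fun t => (cr.1 * (t + cr.2)^-1)%:E +
      (\sum_(x <- s) x.1 * (t + x.2)^-1)%:E)%E); last first.
    by apply/funext => t; rewrite big_cons EFinD.
  exact: integrableD.
rewrite E RintegralD // big_cons IE RintegralZl //.
by apply: H; rewrite mem_head.
Qed.

Lemma cauchy_stieltjes_real (R : realType) (f : R[i] -> R[i]) :
  cauchy_stieltjes f ->
  exists mu : {measure set (measurableTypeR R) -> \bar R},
    forall x : R, 0 < x ->
      mu.-integrable `[0, +oo[%classic (fun t => ((t + x)^-1)%:E) /\
      f x%:C = (Rintegral mu `[0, +oo[%classic (fun t => (t + x)^-1))%:C.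
Proof.
move=> [mu H]; exists mu => x x0.
have [|[intr inti] ->] := H x%:C.
  by rewrite lecE /= eqxx /= -ltNge.
have E t : ((t%:C + x%:C)^-1 : R[i]) = ((t + x)^-1)%:C.
  by rewrite -rmorphD fmorphV.
split.
  by apply: eq_integrable intr => // t _; rewrite E.
rewrite /cintegral.
have -> : (fun t => complex.Re ((t%:C + x%:C)^-1)) = (fun t => (t + x)^-1).
  by apply/funext => t; rewrite E.
have -> : (fun t => complex.Im ((t%:C + x%:C)^-1)) = cst 0.
  by apply/funext => t; rewrite E.
by rewrite {2}/Rintegral integral0.
Qed.

(** A scalar built from [mxfun f A] depends on finitely many values of [f], linearly; matrix-valued
    integrals are thereby avoided. *)
Lemma inner_mxfun (R : realType) (n : nat) (f : R[i] -> R[i]) (A : 'M[R[i]]_n)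
  (w y : 'cV[R[i]]_n) :
  (w^t* *m mxfun f A *m y) 0 0 = \sum_i
     (w^t* *m invmx (spectralmx A)) 0 i * (spectralmx A *m y) i 0
       * f (spectral_diag A 0 i).
Proof.
rewrite /mxfun !mulmxA -(mulmxA _ (spectralmx A)) mxE; apply: eq_bigr => i _.
by rewrite mul_mx_diag [X in X * _ = _]mxE [map_mx _ _ _ _]mxE mulrAC.
Qed.

(** * The transformation [T_C] and approximation of the resolvent *)

Lemma Delta_itv (R : realType) (a b : R) : 0 < a < b -> 0 < Delta a b < b.
Proof.
move=> /andP[a0 ab]; have b0 : 0 < b by lra.
have h : 0 < b ^+ 2 - a * b.
  have -> : b ^+ 2 - a * b = b * (b - a) by ring.
  by rewrite mulr_gt0 // subr_gt0.
rewrite /Delta sqrtr_gt0 h /= -[ltRHS](ger0_norm (ltW b0)) -sqrtr_sqr ltr_sqrt.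
  by rewrite ltrBlDr ltrDl mulr_gt0.
by rewrite exprn_gt0.
Qed.

Lemma Delta_sqr (R : realType) (a b : R) : 0 < a < b ->
  Delta a b ^+ 2 = b ^+ 2 - a * b.
Proof.
move=> /andP[a0 ab]; have b0 : 0 < b by lra.
rewrite sqr_sqrtr //; have -> : b ^+ 2 - a * b = b * (b - a) by ring.
by rewrite mulr_ge0 // ?(ltW b0) // subr_ge0 ltW.
Qed.

Lemma ahat_itv (R : realType) (a b : R) : 0 < a < b -> 0 < ahat a b < 1.
Proof.
move=> ab; have /andP[D0 Db] := Delta_itv ab.
have h : 0 < b + Delta a b by lra.
by rewrite divr_gt0 ?subr_gt0 //= ltr_pdivrMr // mul1r; lra.
Qed.

(** From [(b - Delta a b) * (b + Delta a b) = a * b] and [Delta a b <= b], the inverse of [ahat a b]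
    is at most [4 * b / a]. *)
Lemma rho_ahat_le (R : realType) (a b : R) : 0 < a < b ->
  rho (ahat a b) 1 <= rho a (4 * b).
Proof.
move=> ab; have /andP[a0 lab] := ab; have /andP[D0 Db] := Delta_itv ab.
have DD := Delta_sqr ab; have /andP[h0 h1] := ahat_itv ab.
have h : 0 < b + Delta a b by lra.
have l1 : 0 < ln (4 * 1 / ahat a b) by rewrite ln_gt0 // ltr_pdivlMr //; lra.
rewrite /rho ler_expR lerN2.
have le : 4 * 1 / ahat a b <= 4 * (4 * b) / a.
  have bD : 0 < b - Delta a b by lra.
  have E : (b - Delta a b) * (b + Delta a b) = a * b.
    by lra.
  have H : a * (b + Delta a b) ^+ 2 <= a * (2 * b) ^+ 2.
    by rewrite ler_pM2l // lerXn2r ?nnegrE //; lra.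
  have -> : 4 * 1 / ahat a b = 4 * (b + Delta a b) / (b - Delta a b).
    by rewrite /ahat; field; rewrite !gt_eqF.
  rewrite ler_pdivrMr // mulrAC ler_pdivlMr //.
  rewrite -(ler_pM2r h) -[leRHS]mulrA E.
  by lra.
have le2 : ln (4 * 1 / ahat a b) <= ln (4 * (4 * b) / a).
  by rewrite ler_ln ?posrE ?divr_gt0 ?mulr_gt0 //; lra.
have l2 := lt_le_trans l1 le2.
by rewrite ler_wpM2l ?sqr_ge0 // lef_pV2.
Qed.

(* [T_C(z) + p] and [T_C(z) - p], times [b + Delta - z]; a pole at infinity
   ([p = -1]) makes the second one constant. *)
Definition TC_num (R : realType) (a b p : R) : {poly R} :=
  (1 - p) *: 'X - (b - Delta a b - p * (b + Delta a b))%:P.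

Definition TC_den (R : realType) (a b p : R) : {poly R} :=
  (1 + p) *: 'X - (b - Delta a b + p * (b + Delta a b))%:P.

(** A finite pole contributes [1 + p] to the constant [k]; the pole at infinity, [p = -1],
    contributes [2 * Delta a b]. *)
Lemma TC_den_poles (R : realType) (a b : R) (psi : seq R) : 0 < a < b ->
  exists2 k : R, k != 0 & forall z : R[i],
    (map_poly (real_complex R) (\prod_(p <- psi) TC_den a b p)).[z]
      = k%:C * \prod_(x <- pmap id [seq TC_inv a b p%:C | p <- psi]) (z - x).
Proof.
move=> ab; have /andP[D0 Db] := Delta_itv ab.
elim: psi => [|p psi [k k0 IH]].
  by exists 1; rewrite ?oner_eq0 // => z; rewrite !big_nil rmorph1 hornerC mulr1.
have denE z : (map_poly (real_complex R) (TC_den a b p)).[z] =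
    (1 + p%:C) * z - ((b - Delta a b)%:C + p%:C * (b + Delta a b)%:C).
  rewrite /TC_den rmorphB /= map_polyZ map_polyX map_polyC !hornerE.
  have -> : 1 + p%:C = (1 + p)%:C by rewrite rmorphD rmorph1.
  have -> : (b - Delta a b)%:C + p%:C * (b + Delta a b)%:C
    = (b - Delta a b + p * (b + Delta a b))%:C by rewrite -rmorphM -rmorphD.
  by [].
have [p1|p1] := eqVneq p (-1).
  exists ((2 * Delta a b) * k); first by rewrite mulf_neq0 // gt_eqF // mulr_gt0.
  move=> z; rewrite big_cons rmorphM hornerM IH denE /= /TC_inv p1.
  rewrite rmorphN1 eqxx /= subrr mul0r sub0r mulN1r !(rmorphD, rmorphM, rmorphB, rmorph_nat).
  by ring.
exists ((1 + p) * k); first by rewrite mulf_neq0 // addrC addr_eq0.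
move=> z; rewrite big_cons rmorphM hornerM IH denE /= /TC_inv.
have p1' : (p%:C == -1) = false.
  by rewrite -(rmorphN1 (real_complex R)) (inj_eq (@complexI R)) (negbTE p1).
rewrite p1' /= big_cons !(rmorphD, rmorphM, rmorphB, rmorph1).
have p1n : 1 + p%:C != 0 by rewrite addrC addr_eq0 p1'.
by field.
Qed.

(** Here [z = T_C(x)]. The value of [Delta] makes [T_C] send [a], [b], 0 and infinity to [ahat], 1,
    [- ahat] and [-1], so that the spectral interval and the half-line of the shifts go to opposite
    intervals. *)
Lemma TC_frac_spectrum (R : realType) (a b x : R) (psi : seq R) : 0 < a < b ->
  a <= x <= b -> {in psi, forall p, -1 <= p <= - ahat a b} ->
  (\prod_(p <- psi) TC_den a b p).[x] != 0 /\
  exists2 z, ahat a b <= z <= 1 &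
  `|(\prod_(p <- psi) TC_num a b p).[x] / (\prod_(p <- psi) TC_den a b p).[x]|
    = blaschke [seq - p | p <- psi] z.
Proof.
move=> ab /andP[ax xb] psia; have /andP[D0 Db] := Delta_itv ab.
have /andP[a0 lab] := ab; have DD := Delta_sqr ab; have /andP[h0 h1] := ahat_itv ab.
have hx : 0 < b + Delta a b - x by lra.
have hb : 0 < b + Delta a b by lra.
pose z := (x - (b - Delta a b)) / (b + Delta a b - x).
have zE : z * (b + Delta a b - x) = x - (b - Delta a b) by rewrite divfK // gt_eqF.
have az : ahat a b <= z <= 1.
  rewrite /ahat /z ler_pdivrMr // mulrAC ler_pdivlMr // ler_pdivrMr // mul1r.
  apply/andP; split; last by lra.
  have : 0 <= 2 * b * (x - a) by rewrite mulr_ge0 //; lra.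
  have -> : 2 * b * (x - a) = 2 * b * x - 2 * (a * b) by ring.
  have -> : a * b = b ^+ 2 - Delta a b ^+ 2 by lra.
  by lra.
have /andP[az1 az2] := az.
have denE p : (TC_den a b p).[x] = (b + Delta a b - x) * (z - p).
  by rewrite /TC_den !hornerE; lra.
have numE p : (TC_num a b p).[x] = (b + Delta a b - x) * (z + p).
  by rewrite /TC_num !hornerE; lra.
have zp p : p \in psi -> 0 < z - p by move=> /psia /andP[h2 h3]; lra.
split.
  rewrite horner_prod prodf_seq_neq0; apply/allP => p /zp h /=.
  by rewrite denE mulf_neq0 // gt_eqF.
exists z => //; rewrite !horner_prod -prodf_div normr_prod /blaschke big_map.
apply: eq_big_seq => p /zp h.
rewrite numE denE -mulf_div divff ?mul1r ?gt_eqF // normrM normfV (gtr0_norm h).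
by rewrite opprK.
Qed.

(** Here [- z = T_C(- t)]; the quotient is the inverse of the one on the spectrum, since reflection
    inverts it. *)
Lemma TC_frac_neg (R : realType) (a b t : R) (psi : seq R) : 0 < a < b ->
  0 <= t -> {in psi, forall p, -1 <= p <= - ahat a b} ->
  (\prod_(p <- psi) TC_num a b p).[- t] != 0 /\
  exists2 z, ahat a b <= z <= 1 &
  `|(\prod_(p <- psi) TC_den a b p).[- t] / (\prod_(p <- psi) TC_num a b p).[- t]|
    = blaschke [seq - p | p <- psi] z.
Proof.
move=> ab t0 psia; have /andP[D0 Db] := Delta_itv ab.
have /andP[h0 h1] := ahat_itv ab.
have ht : 0 < b + Delta a b + t by lra.
have hb : 0 < b + Delta a b by lra.
pose z := (t + (b - Delta a b)) / (b + Delta a b + t).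
have zE : z * (b + Delta a b + t) = t + (b - Delta a b) by rewrite divfK // gt_eqF.
have az : ahat a b <= z <= 1.
  rewrite /ahat /z ler_pdivrMr // mulrAC ler_pdivlMr // ler_pdivrMr // mul1r.
  apply/andP; split; last by lra.
  have : 0 <= 2 * Delta a b * t by rewrite !mulr_ge0 // ltW.
  by lra.
have /andP[az1 az2] := az.
have denE p : (TC_den a b p).[- t] = - ((b + Delta a b + t) * (z + p)).
  by rewrite /TC_den !hornerE; lra.
have numE p : (TC_num a b p).[- t] = - ((b + Delta a b + t) * (z - p)).
  by rewrite /TC_num !hornerE; lra.
have zp p : p \in psi -> 0 < z - p by move=> /psia /andP[h2 h3]; lra.
split.
  rewrite horner_prod prodf_seq_neq0; apply/allP => p /zp h /=.
  by rewrite numE oppr_eq0 mulf_neq0 // gt_eqF.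
exists z => //; rewrite !horner_prod -prodf_div normr_prod /blaschke big_map.
apply: eq_big_seq => p /zp h.
rewrite numE denE invrN mulrNN -mulf_div divff ?mul1r ?gt_eqF // normrM normfV.
by rewrite (gtr0_norm h) opprK.
Qed.

(* [1 / (t + z)] differs from a rational function with the given poles by
   [kappa R(z) / (t + z)], where [R] has these poles and [kappa = 1 / R(-t)]. *)
Lemma resolvent_approx (R : realType) (a b t eps : R) (psi : seq R) :
  0 < a < b -> 0 <= t ->
  {in psi, forall p, -1 <= p <= - ahat a b} -> 0 <= eps ->
  (forall z, ahat a b <= z <= 1 -> blaschke [seq - p | p <- psi] z <= eps) ->
  exists (g : R -> R) (P : {poly R[i]}), (size P <= (size psi).+1)%N /\
    forall x, a <= x <= b ->
    [/\ `|g x| <= eps ^+ 2 / (t + a),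
      \prod_(y <- pmap id [seq TC_inv a b p%:C | p <- psi]) (x%:C - y) != 0 &
      (t%:C + x%:C)^-1 = (g x)%:C + P.[x%:C] /
        \prod_(y <- pmap id [seq TC_inv a b p%:C | p <- psi]) (x%:C - y)].
Proof.
move=> ab t0 psia e0 beps; have /andP[a0 lab] := ab.
set N := \prod_(p <- psi) TC_num a b p; set D := \prod_(p <- psi) TC_den a b p.
have [Nt [zt zta Et]] := TC_frac_neg ab t0 psia; rewrite -/N -/D in Nt Et.
pose kap := D.[- t] / N.[- t].
have [k k0 qE] := TC_den_poles psi ab.
have size_lin (c d : R) : (size (c *: 'X - d%:P)%R <= 2)%N.
  rewrite (leq_trans (size_polyD _ _)) // geq_max size_polyN.
  rewrite (leq_trans (size_scale_leq _ _)) ?size_polyX //=.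
  by rewrite (leq_trans (size_polyC_leq1 _)).
have size_pr (F : R -> {poly R}) : (forall p, size (F p) <= 2)%N ->
    (size (\prod_(p <- psi) F p)%R <= (size psi).+1)%N.
  move=> sF; elim: (psi) => [|p s IH]; first by rewrite big_nil size_poly1.
  rewrite big_cons (leq_trans (size_polyMleq _ _)) //.
  by have := sF p; move: IH => /=; move: (size _) (size _) => u w; lia.
(* [kap] is chosen to make [D - kap * N] vanish at [- t]; the cofactor of ['X + t] is the numerator
   of the approximant, up to [k]. *)
have /factor_theorem[P PE] : root (D - kap *: N) (- t).
  by rewrite /root !hornerE divfK // subrr.
have sP : (size P <= (size psi).+1)%N.
  have [->|P0] := eqVneq P 0; first by rewrite size_poly0.
  have : (size (D - kap *: N)%R <= (size psi).+1)%N.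
    rewrite (leq_trans (size_polyD _ _)) // geq_max size_polyN.
    apply/andP; split; last apply: leq_trans (size_scale_leq _ _) _;
    by apply: size_pr => p; exact: size_lin.
  rewrite PE size_Mmonic ?monicXsubC // size_XsubC addn2 /=.
  exact: ltnW.
exists (fun x => kap * (N.[x] / D.[x]) / (t + x)).
exists ((k^-1)%:C *: map_poly (real_complex R) P); split.
  by rewrite (leq_trans (size_scale_leq _ _)) // size_map_poly.
move=> x xab; have [Dx [zx zxa Ex]] := TC_frac_spectrum ab xab psia.
rewrite -/N -/D in Dx Ex; have /andP[ax xb] := xab.
have tx : 0 < t + x by lra.
have ta : 0 < t + a by lra.
have DE : (D.[x])%:C = k%:C *
    \prod_(y <- pmap id [seq TC_inv a b p%:C | p <- psi]) (x%:C - y).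
  by rewrite -qE horner_map.
have q0 : \prod_(y <- pmap id [seq TC_inv a b p%:C | p <- psi]) (x%:C - y) != 0.
  apply: contra_neq Dx => q0; apply: (@complexI R); rewrite DE q0 mulr0.
  by rewrite rmorph0.
split=> //.
  rewrite normrM normfV (gtr0_norm tx) (normrM kap); apply: ler_pM => //.
  - by rewrite invr_ge0 ltW.
  - rewrite expr2; apply: ler_pM => //.
      by rewrite /kap Et; exact: beps.
    by rewrite Ex; exact: beps.
  - by rewrite lef_pV2 ?posrE // lerD2l.
have kC : k%:C != 0 :> R[i] by rewrite fmorph_eq0.
rewrite hornerZ horner_map.
set q := \prod_(y <- _) _ in DE q0 *.
have -> : q = (D.[x])%:C / k%:C by rewrite DE mulrC mulKf.
have /(congr1 (fun p => p.[x])) := PE; rewrite !hornerE opprK => PEx.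
have PE' : P.[x] = (D.[x] - kap * N.[x]) / (t + x).
  by rewrite PEx (addrC x) mulfK // gt_eqF.
have E : (t + x)^-1 = kap * (N.[x] / D.[x]) / (t + x) + k^-1 * P.[x] / (D.[x] / k).
  by rewrite PE'; field; rewrite Dx k0 gt_eqF.
have -> : (t%:C + x%:C)^-1 = ((t + x)^-1)%:C :> R[i].
  by rewrite fmorphV rmorphD.
have F : (k^-1 * P.[x] / (D.[x] / k))%:C
    = (k^-1)%:C * (P.[x])%:C / ((D.[x])%:C / k%:C) :> R[i].
  by rewrite !rmorphM !fmorphV rmorphM fmorphV.
have G : ((t + x)^-1)%:C = (kap * (N.[x] / D.[x]) / (t + x))%:C
    + (k^-1)%:C * (P.[x])%:C / ((D.[x])%:C / k%:C) :> R[i].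
  by rewrite -F [in LHS]E; exact: (rmorphD (real_complex R)).
by rewrite [LHS]G; congr ((_ / _)%:C + _); exact: mulrA.
Qed.

(** * Error of the Krylov approximation *)

Lemma complex_itv_real (R : realType) (a b : R) (z : R[i]) :
  a%:C <= z <= b%:C -> z = (complex.Re z)%:C /\ a <= complex.Re z <= b.
Proof.
case: z => x y; rewrite !lecE /= => /andP[/andP[/eqP y0 ax] /andP[_ xb]].
by rewrite y0 ax xb.
Qed.

(** By [rat_krylov_exact] the rational parts cancel. The remainders for [A] and for [Al] are at most
    [eps ^+ 2 / (t + a)] each on the spectra, hence the factor 2. *)
Lemma resolvent_error (R : realType) (n s k l : nat) (a b t eps : R)
  (A : 'M[R[i]]_n) (v : 'M[R[i]]_(n, s)) (psi : l.-tuple R)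
  (U : 'M[R[i]]_(n, k)) (w : 'cV[R[i]]_n) (x : 'cV[R[i]]_s) :
  let Al := U^t* *m A *m U in
  let F (z : R[i]) := (t%:C + z)^-1 in
  0 < a < b -> 0 <= t ->
  {in psi, forall p, -1 <= p <= - ahat a b} -> 0 <= eps ->
  (forall z, ahat a b <= z <= 1 -> blaschke [seq - p | p <- psi] z <= eps) ->
  A \is hermsymmx ->
  (forall i, a%:C <= spectral_diag A 0 i <= b%:C) ->
  orthonormal_basis U (rat_krylov A v (PsiC a b psi)) ->
  complex.Re ((w^t* *m (mxfun F A - U *m mxfun F Al *m U^t*) *m (v *m x)) 0 0)
    <= 2 * eps ^+ 2 * (eucl_norm w * eucl_norm (v *m x)) * (t + a)^-1.
Proof.
move=> Al F ab t0 psia e0 beps Ah dA UV; have [UU _] := UV.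
have [Alh dAl] := compression_spectral_itv Ah dA UU; rewrite -/Al in Alh dAl.
have An := hermitian_normalmx Ah; have Aln := hermitian_normalmx Alh.
have [g [P [sP gP]]] := resolvent_approx ab t0 psia e0 beps.
rewrite size_tuple in sP.
pose q z := \prod_(y <- pmap id (PsiC a b psi)) (z - y).
pose G (z : R[i]) := (g (complex.Re z))%:C.
have ta : 0 < t + a by case/andP: ab => a0 _; lra.
have M0 : 0 <= eps ^+ 2 / (t + a) by rewrite divr_ge0 ?sqr_ge0 // ltW.
have split m (B : 'M[R[i]]_m) : (forall i, a%:C <= spectral_diag B 0 i <= b%:C) ->
    [/\ mxfun F B = mxfun G B + mxfun (fun z => P.[z] / q z) B,
        forall i, q (spectral_diag B 0 i) != 0 &
        forall y, eucl_norm (mxfun G B *m y) <= eps ^+ 2 / (t + a) * eucl_norm y].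
  move=> dB; split.
  - rewrite -mxfunD; apply: mxfun_ext => i.
    have [dE dab] := complex_itv_real (dB i); have [_ _ E] := gP _ dab.
    by rewrite dE /F E.
  - move=> i; have [dE dab] := complex_itv_real (dB i); have [_ + _] := gP _ dab.
    by rewrite dE.
  - move=> y; apply: eucl_norm_mxfun_le => // i.
    have [_ dab] := complex_itv_real (dB i); have [gle _ _] := gP _ dab.
    by rewrite /G normc_real.
have [FA qA GA] := split _ _ dA; have [FAl qAl GAl] := split _ _ dAl.
have ex := rat_krylov_exact An Aln qA qAl UV sP.
set y := v *m x.
have -> : w^t* *m (mxfun F A - U *m mxfun F Al *m U^t*) *m y
   = w^t* *m (mxfun G A *m y) - w^t* *m (U *m (mxfun G Al *m (U^t* *m y))).
  have exy : mxfun (fun z => P.[z] / q z) A *m y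
      = U *m mxfun (fun z => P.[z] / q z) Al *m U^t* *m y.
    by rewrite /y mulmxA ex !mulmxA.
  rewrite FA FAl; move: exy.
  move: (mxfun G A) (mxfun _ A) (mxfun G Al) (mxfun _ Al) => X1 X2 Y1 Y2 XY.
  rewrite -mulmxA -mulmxBr; congr (_ *m _).
  by rewrite (mulmxDr U) mulmxBl !mulmxDl XY opprD addrACA subrr addr0 !mulmxA.
rewrite [X in complex.Re X](_ : _ = (w^t* *m (mxfun G A *m y)) 0 0
    + (w^t* *m - (U *m (mxfun G Al *m (U^t* *m y)))) 0 0); last first.
  by rewrite mulmxN [LHS]mxE.
rewrite (raddfD (@complex.Re R : Rcomplex R -> R)) /=.
have normN (u : 'cV[R[i]]_n) : eucl_norm (- u) = eucl_norm u.
  by rewrite /eucl_norm; congr Num.sqrt; apply: eq_bigr => i _; rewrite mxE normcN.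
have -> : 2 * eps ^+ 2 * (eucl_norm w * eucl_norm y) * (t + a)^-1 =
    eucl_norm w * (eps ^+ 2 / (t + a) * eucl_norm y)
    + eucl_norm w * (eps ^+ 2 / (t + a) * eucl_norm y) by ring.
apply: lerD; apply: (le_trans (Re_le_normc _)); apply: (le_trans (norm_inner_le _ _)).
  by rewrite ler_wpM2l ?eucl_norm_ge0.
rewrite ler_wpM2l ?eucl_norm_ge0 // normN eucl_norm_isometry //.
apply: (le_trans (GAl _)); rewrite ler_wpM2l //.
exact: eucl_norm_adjoint_le.
Qed.

(** The nodes and signed weights in [s] are chosen before [f], so one finite rule serves both the
    Cauchy-Stieltjes function and the resolvents at all shifts. *)
Lemma compression_functional (R : realType) (n k : nat) (a b : R)
  (A : 'M[R[i]]_n) (U : 'M[R[i]]_(n, k)) (w y : 'cV[R[i]]_n) :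
  let Al := U^t* *m A *m U in
  (forall i, a%:C <= spectral_diag A 0 i <= b%:C) ->
  (forall i, a%:C <= spectral_diag Al 0 i <= b%:C) ->
  exists2 s : seq (R * R), (forall cr, cr \in s -> a <= cr.2 <= b) &
  forall f h, (forall x, a <= x <= b -> f x%:C = (h x)%:C) ->
    complex.Re ((w^t* *m (mxfun f A - U *m mxfun f Al *m U^t*) *m y) 0 0)
      = \sum_(cr <- s) cr.1 * h cr.2.
Proof.
move=> Al dA dAl.
pose c (i : 'I_n) := complex.Re
  ((w^t* *m invmx (spectralmx A)) 0 i * (spectralmx A *m y) i 0).
pose e (j : 'I_k) := complex.Re
  (((U^t* *m w)^t* *m invmx (spectralmx Al)) 0 j * (spectralmx Al *m (U^t* *m y)) j 0).
exists ([seq (c i, complex.Re (spectral_diag A 0 i)) | i <- index_enum 'I_n] ++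
        [seq (- e j, complex.Re (spectral_diag Al 0 j)) | j <- index_enum 'I_k]).
  move=> cr; rewrite mem_cat => /orP[] /mapP[i _ ->] /=.
    by have [] := complex_itv_real (dA i).
  by have [] := complex_itv_real (dAl i).
move=> f h fh.
have Re_mul (z : R[i]) (r : R) : complex.Re (z * r%:C) = complex.Re z * r.
  by case: z => u u'; rewrite /= mulr0 subr0.
have Re_sum (I : finType) (F : I -> R[i]) :
    complex.Re (\sum_i F i) = \sum_i complex.Re (F i).
  exact: (raddf_sum (@complex.Re R : Rcomplex R -> R)).
rewrite big_cat /= !big_map /=.
have -> : w^t* *m (mxfun f A - U *m mxfun f Al *m U^t*) *m y =
    w^t* *m mxfun f A *m y - (U^t* *m w)^t* *m mxfun f Al *m (U^t* *m y).
  by rewrite mulmxBr mulmxBl trmxC_mul trmxCK !mulmxA.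
rewrite [X in complex.Re X](_ : _ = (w^t* *m mxfun f A *m y) 0 0
    - ((U^t* *m w)^t* *m mxfun f Al *m (U^t* *m y)) 0 0); last first.
  by rewrite [LHS]mxE [X in _ + X]mxE.
rewrite (raddfB (@complex.Re R : Rcomplex R -> R)) /= !inner_mxfun !Re_sum.
congr (_ + _).
  apply: eq_bigr => i _; have [dE dab] := complex_itv_real (dA i).
  by rewrite [in LHS]dE fh // Re_mul.
rewrite -sumrN; apply: eq_bigr => j _; have [dE dab] := complex_itv_real (dAl j).
by rewrite [in LHS]dE fh // Re_mul mulNr.
Qed.

Theorem corollary3p18 (R : realType) (n s k l : nat) (a b : R)
    (A : 'M[R[i]]_n) (v : 'M[R[i]]_(n, s)) (f : R[i] -> R[i])
    (psi : l.-tuple R) (U : 'M[R[i]]_(n, k))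
    (a_gt0 : 0 < a) (lt_ab : a < b)
    (A_posdef : posdefmx A)
    (A_spec : forall x : R[i], eigenvalue A x -> a%:C <= x <= b%:C)
    (f_cs : cauchy_stieltjes f)
    (l_ge1 : (1 <= l)%N)
    (psi_zolo : zolotarev_poles (ahat a b) 1 psi)
    (U_basis : orthonormal_basis U (rat_krylov A v (PsiC a b psi))) :
  let Al := U^t* *m A *m U in
  let vl := U^t* *m v in
  let xl := U *m mxfun f Al *m vl in
  (spec_norm (mxfun f A *m v - xl))%:C
    <= 8 * f a%:C * (spec_norm v)%:C * (rho a (4 * b))%:C ^+ l.
Proof.
cbv zeta; set Al := U^t* *m A *m U; set vl := U^t* *m v; set xl := U *m _ *m vl.
have ab : 0 < a < b by rewrite a_gt0.
have [Ah _] := A_posdef; have An := hermitian_normalmx Ah.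
have [UU _] := U_basis.
have dA i : a%:C <= spectral_diag A 0 i <= b%:C.
  exact/A_spec/spectral_diag_eigenvalue.
have [_ dAl] := compression_spectral_itv Ah dA UU; rewrite -/Al in dAl.
have [eps [e0 beps eps2]] := zolotarev_bound (ahat_itv ab) l_ge1 psi_zolo.
have psia : {in psi, forall p, -1 <= p <= - ahat a b} by exact: psi_zolo.1.
have [mu mu_f] := cauchy_stieltjes_real f_cs.
pose I x := Rintegral mu `[0, +oo[%classic (fun t => (t + x)^-1).
have [inta faE] := mu_f a a_gt0.
have I0 : 0 <= I a.
  apply: Rintegral_ge0 => t; rewrite /= in_itv /= andbT => t0.
  by rewrite invr_ge0 addr_ge0 // ltW.
rewrite faE -/(I a).
have -> : 8 * (I a)%:C * (spec_norm v)%:C * (rho a (4 * b))%:C ^+ l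
    = (8 * I a * spec_norm v * rho a (4 * b) ^+ l)%:C :> R[i].
  by rewrite !rmorphM rmorphXn rmorph_nat.
rewrite lecR.
have r0 : 0 <= rho a (4 * b) by exact: expR_ge0.
have err y : eucl_norm ((mxfun f A - U *m mxfun f Al *m U^t*) *m (v *m y))
    <= 2 * eps ^+ 2 * I a * eucl_norm (v *m y).
  (* The error vector is tested against itself: with the left factor [w] held fixed, the square of
     its norm is linear in the values of [f]. *)
  set E := mxfun f A - _; set w := E *m (v *m y).
  have [->|w0] := eqVneq (eucl_norm w) 0.
    by rewrite !mulr_ge0 ?sqr_ge0 ?eucl_norm_ge0.
  have {}w0 : 0 < eucl_norm w by rewrite lt_neqAle eq_sym w0 eucl_norm_ge0.
  have [sq sqab sqE] := @compression_functional R n k a b A U w (v *m y) dA dAl.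
  rewrite -(ler_pM2l w0) -expr2.
  have -> : eucl_norm w ^+ 2 = complex.Re ((w^t* *m E *m (v *m y)) 0 0).
    by rewrite -mulmxA -/w -eucl_norm_sqr.
  rewrite (sqE f I) => [|x /andP[ax _]]; last first.
    by have [|_ ->] := mu_f x; first exact: lt_le_trans ax.
  have mD : measurable (`[0, +oo[%classic : set (measurableTypeR R)).
    exact: measurable_itv.
  have [cr /sqab /andP[ac _]|int IE] := @Rintegral_sum_cauchy R mu _ sq mD.
    by have [] := mu_f cr.2 (lt_le_trans a_gt0 ac).
  rewrite -IE.
  set B := 2 * eps ^+ 2 * (eucl_norm w * eucl_norm (v *m y)).
  have -> : eucl_norm w * (2 * eps ^+ 2 * I a * eucl_norm (v *m y)) = B * I a.
    by rewrite /B; ring.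
  rewrite -RintegralZl //; apply: le_Rintegral => //.
    rewrite (_ : _ \o _ = (fun t => B%:E * ((t + a)^-1)%:E)%E).
      exact: integrableZl.
    by apply/funext => t /=; rewrite EFinM.
  move=> t; rewrite /= in_itv /= andbT => t0.
  (* For each [t] the integrand is the same finite rule applied to [1 / (t + z)], that is, the error
     of a resolvent. *)
  rewrite -(sqE (fun z => (t%:C + z)^-1) (fun x => (t + x)^-1)) => [|x _].
    exact: (resolvent_error w y ab t0 psia e0 beps Ah dA U_basis).
  by rewrite -rmorphD fmorphV.
apply: spec_norm_le => y y1.
have -> : (mxfun f A *m v - xl) *m y
    = (mxfun f A - U *m mxfun f Al *m U^t*) *m (v *m y).
  by rewrite /xl /vl !mulmxBl !mulmxA.
apply: (le_trans (err y)).
have eps2' : 2 * eps ^+ 2 <= 8 * rho a (4 * b) ^+ l.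
  have : rho (ahat a b) 1 ^+ l <= rho a (4 * b) ^+ l.
    by rewrite lerXn2r ?nnegrE ?expR_ge0 // rho_ahat_le.
  by lra.
have vy := eucl_norm_mul_le_spec_norm v y1.
apply: (@le_trans _ _ (8 * rho a (4 * b) ^+ l * I a * spec_norm v)).
  apply: ler_pM => //; rewrite ?eucl_norm_ge0 ?mulr_ge0 ?sqr_ge0 //.
  by apply: ler_wpM2r.
by rewrite le_eqVlt; apply/orP; left; apply/eqP; ring.
Qed.
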